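(* Let $B$ be a ring of integers of a global field, that is, either $B$ is the integral closure of $\mathbb{Z}$ in a number field $K$, or $B$ is the integral closure of $\mathbb{F}_q[t]$ in a global function field $K$, for some $t\in K$ transcendental over $\mathbb{F}_q$. Then $B$ is a ring of class (G) over $\mathbb{Z}$ or over $\mathbb{F}_q[t]$, respectively. (In particular, $\mathbb{Z}$, respectively $\mathbb{F}_q[t]$, is a basic PID.)
   Context: All rings are commutative with identity; $\mathbb{N}$ denotes the positive integers. A ring $R$ is called a finite quotient domain if $R$ is an integral domain and $R/I$ is finite for every nonzero ideal $I$ of $R$. The ideal norm on such an $R$ is the function $N_R:R\to\mathbb{N}\cup\{0\}$ given by $N_R(x)=|R/xR|$ for $x\neq 0$ and $N_R(0)=0$. A PID $A$ is called a basic PID if it is not a field and: (1) $A$ is a finite quotient domain; (2) there exists a constant $c\in\mathbb{N}$ such that for each $m\in\mathbb{N}$, $\#\{x\in A\mid N_A(x)\leq c\cdot m\}\geq m$ (this set being allowed to be infinite); (3) there exists a constant $C\in\mathbb{N}$ such that for all $x,y\in A$, $N_A(x+y)\leq C\cdot(N_A(x)+N_A(y))$. Let $A$ be a basic PID. A Dedekind domain $B$ is called a ring of class (G) over $A$ if $B$ is an $A$-algebra that is finitely generated and free as an $A$-module. A global field is either a finite extension of $\mathbb{Q}$ (a number field) or a finite separable extension of some $\mathbb{F}_q(t)$, where $\mathbb{F}_q$ is a finite field and $t$ is transcendental over $\mathbb{F}_q$ (a global function field). In the function field case, a ring of integers is the integral closure in $K$ of $\mathbb{F}_q[t]$ for some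 (any) choice of $t\in K$ transcendental over $\mathbb{F}_q$; the extension $K/\mathbb{F}_q(t)$ for this chosen $t$ is finite but not required to be separable. *)

(* Defs.v *)
From HB Require Import structures.
From mathcomp Require Import all_boot all_order all_algebra all_field finmap.
From mathcomp Require Import boolp classical_sets functions cardinality.

Set Implicit Arguments.
Unset Strict Implicit.
Unset Printing Implicit Defensive.

Import GRing.Theory.

Local Open Scope classical_set_scope.
Local Open Scope ring_scope.

Section Ideals.
Variable R : comNzRingType.
Implicit Types (I P : set R) (a : R).

(* The [idealr_closed] predicate of ring_quotient only covers proper ideals,   *)
(* and only boolean ones.                                                      *)
Definition is_ideal I :=
  [/\ I 0, forall x y, I x -> I y -> I (x + y) & forall a x, I x -> I (a * x)].

Definition principal_ideal a : set R := range (fun r => r * a).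

Definition generated_ideal (s : seq R) : set R :=
  [set x | exists c : 'I_(size s) -> R, x = \sum_i c i * s`_i].

Definition prime_ideal P :=
  [/\ is_ideal P, P != setT & forall x y, P (x * y) -> P x \/ P y].

Definition maximal_ideal P :=
  [/\ is_ideal P, P != setT &
      forall I, is_ideal I -> P `<=` I -> I = P \/ I = setT].

(* R/I, as the set of the cosets a + I *)
Definition ideal_cosets I : set (set R) :=
  range (fun a => [set x | I (x - a)]).

Definition noetherian := forall I, is_ideal I -> exists s, I = generated_ideal s.

End Ideals.

Definition principal_ideal_domain (R : idomainType) :=
  forall I : set R, is_ideal I -> exists a, I = principal_ideal a.

Definition finite_quotient_domain (R : idomainType) :=
  forall I : set R, is_ideal I -> I != [set 0] -> finite_set (ideal_cosets I).

(* [fset_set] returns the empty set on an infinite set, so for x != 0 this is  *)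
(* |R/xR| as soon as R/xR is finite, as in any finite quotient domain.         *)
Definition ideal_norm (R : idomainType) (x : R) : nat :=
  if x == 0 then 0%N else #|` fset_set (ideal_cosets (principal_ideal x)) |%N.

Definition is_field (R : idomainType) := forall x : R, x != 0 -> x \is a GRing.unit.

Record basic_PID (A : idomainType) : Prop := BasicPID {
  basic_PID_principal : principal_ideal_domain A;
  basic_PID_not_field : ~ is_field A;
  basic_PID_finite_quotient : finite_quotient_domain A;
  basic_PID_many_elements : exists2 c : nat, (0 < c)%N &
    forall m : nat, (0 < m)%N ->
      (`I_m #<= [set x : A | (ideal_norm x <= c * m)%N])%card;
  basic_PID_quasi_triangle : exists2 C : nat, (0 < C)%N &
    forall x y : A,
      (ideal_norm (x + y) <= C * (ideal_norm x + ideal_norm y))%N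
}.

Definition integrally_closed (R : idomainType) :=
  forall z : {fraction R},
    integralOver (@FracField.tofrac R) z -> exists r : R, z = FracField.tofrac r.

(* With this convention fields are Dedekind domains. *)
Definition dedekind_domain (R : idomainType) :=
  [/\ noetherian R, integrally_closed R &
      forall P : set R, prime_ideal P -> P != [set 0] -> maximal_ideal P].

(* B is regarded as an A-algebra through the structure morphism phi. *)
Section Algebra.
Variables (A B : comNzRingType) (phi : {rmorphism A -> B}).

Definition generating_family n (b : 'I_n -> B) :=
  forall x : B, exists c : 'I_n -> A, x = \sum_i phi (c i) * b i.

Definition independent_family n (b : 'I_n -> B) :=
  forall c : 'I_n -> A, \sum_i phi (c i) * b i = 0 -> forall i, c i = 0.

Definition finite_free_module :=
  exists n (b : 'I_n -> B), generating_family b /\ independent_family b.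

End Algebra.

Definition class_G (A B : idomainType) (phi : {rmorphism A -> B}) :=
  dedekind_domain B /\ finite_free_module phi.

Section IntegralClosure.
Variables (A : comNzRingType) (K : fieldType) (f : {rmorphism A -> K}).

Definition integral_pred : {pred K} := fun z => `[< integralOver f z >].

Fact integral_pred_subring : subring_closed integral_pred.
Proof.
split; first exact/asboolP/integral1.
- by move=> x y /asboolP fx /asboolP fy; apply/asboolP/integral_sub.
- by move=> x y /asboolP fx /asboolP fy; apply/asboolP/integral_mul.
Qed.

HB.instance Definition _ :=
  GRing.isSubringClosed.Build K integral_pred integral_pred_subring.

Record integral_closure :=
  IntegralClosure { icval : K; _ : icval \in integral_pred }.

HB.instance Definition _ := [isSub for icval].
HB.instance Definition _ := [Choice of integral_closure by <:].
HB.instance Definition _ :=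
  [SubChoice_isSubComNzRing of integral_closure by <:].

Let unit_ic : pred integral_closure :=
  fun x => (icval x != 0) && ((icval x)^-1 \in integral_pred).

Let inv_ic (x : integral_closure) : integral_closure :=
  insubd x (icval x)^-1.

Fact mulVx_ic : {in unit_ic, left_inverse 1 inv_ic *%R}.
Proof.
by move=> x /andP[x0 xV]; apply/val_inj; rewrite /= insubdK // mulVf.
Qed.

Fact unitPl_ic (x y : integral_closure) : y * x = 1 -> x \in unit_ic.
Proof.
move=> /(congr1 val) /= yx1.
have x0 : icval x != 0.
  by apply: contra_eq_neq yx1 => ->; rewrite mulr0 eq_sym oner_eq0.
rewrite unfold_in /unit_ic x0 /=.
have -> : (icval x)^-1 = icval y by rewrite -[LHS]mul1r -yx1 mulfK.
exact: valP y.
Qed.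

Fact inv_out_ic : {in [predC unit_ic], inv_ic =1 id}.
Proof.
move=> x; rewrite inE unfold_in /unit_ic negb_and negbK => /orP[/eqP x0|xV].
  by apply/val_inj; rewrite /inv_ic val_insubd /= x0 invr0 if_same.
by apply/val_inj; rewrite /inv_ic val_insubd /= (negbTE xV).
Qed.

HB.instance Definition _ := GRing.ComNzRing_hasMulInverse.Build
  integral_closure mulVx_ic unitPl_ic inv_out_ic.

Fact mulf_eq0_ic : GRing.integral_domain_axiom integral_closure.
Proof.
by move=> x y /(congr1 val) /= /eqP; rewrite mulf_eq0.
Qed.

HB.instance Definition _ :=
  GRing.ComUnitRing_isIntegral.Build integral_closure mulf_eq0_ic.

Fact integral_image a : f a \in integral_pred.
Proof. exact/asboolP/integral_id. Qed.

Definition ic_map (a : A) : integral_closure := IntegralClosure (integral_image a).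

Fact ic_map_zmod_morphism : zmod_morphism ic_map.
Proof. by move=> a b; apply/val_inj; rewrite /= rmorphB. Qed.

Fact ic_map_monoid_morphism : monoid_morphism ic_map.
Proof.
by split=> [|a b]; apply/val_inj; rewrite /= ?rmorph1 ?rmorphM.
Qed.

HB.instance Definition _ := GRing.isZmodMorphism.Build
  A integral_closure ic_map ic_map_zmod_morphism.
HB.instance Definition _ := GRing.isMonoidMorphism.Build
  A integral_closure ic_map ic_map_monoid_morphism.

End IntegralClosure.

(* {fraction {poly F}} is the rational function field F(s); a fieldExtType is  *)
(* of finite degree over its base field.                                       *)
Section FunctionField.
Variables (F : finFieldType) (K : fieldExtType {fraction {poly F}}).

Definition constant_map : F -> K := in_alg K \o @FracField.tofrac _ \o polyC.

HB.instance Definition _ := GRing.RMorphism.on constant_map.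

Definition transcendental (t : K) := ~ algebraicOver constant_map t.

(* The morphism F[X] -> K, X |-> t; for t transcendental it identifies F[X]    *)
(* with the subring F[t] of K.                                                 *)
Definition eval_map (t : K) : {poly F} -> K :=
  horner_eval t \o map_poly constant_map.

HB.instance Definition _ t := GRing.RMorphism.on (eval_map t).

End FunctionField.

(* Main.v *)
Require Import Defs.
From HB Require Import structures.
From mathcomp Require Import all_boot all_order all_algebra all_field finmap.
From mathcomp Require Import boolp classical_sets functions cardinality.
From mathcomp Require Import ring zify.

Set Implicit Arguments.
Unset Strict Implicit.
Unset Printing Implicit Defensive.

Import GRing.Theory.

Local Open Scope classical_set_scope.
Local Open Scope ring_scope.

(** Let [A] be a principal ideal domain with fraction field [k], let [K] be a
    finite extension of [k], and let [B] be the integral closure of [A] in [K].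
    For [B] to be finite and free over [A] it suffices that [B] lies in a finitely
    generated [A]-submodule of [K], because its submodules are then finitely
    generated and torsion-free, hence free ([submodule_basis]).

    Separable part.  Let [theta] be integral over [A] with
    [1, theta, ..., theta ^ (N - 1)] independent, and let [p] be its minimal
    polynomial.  If [x] in [k(theta)] is integral over [A], then
    [p'(theta) x] lies in [A[theta]] ([integral_conductor]).  The proof uses
    neither traces nor conjugates: [A[theta, x]] is free of rank [N] over [A],
    so multiplication by [theta + eps x] has a characteristic polynomial with
    coefficients in [A[eps]], which vanishes at [theta + eps x]; its derivative
    at [eps = 0] reads [x p'(theta) + g(theta) = 0] with [g] in [A[T]] of degree
    less than [N].

    Inseparable part.  An extension of [F(t)] may be inseparable even though [K]
    is separable over some other rational subfield, so [theta] only generates the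
    maximal separable subextension.  There is then a power [q] of the
    characteristic ([q = 1] in characteristic zero) such that
    [y ^ q] lies in [k(theta)] for all [y] in [K].  Raising to the power [q] is
    an injective ring morphism on [K], so that it is equivalent to find a basis
    of the [q]-th powers of [B] over the [q]-th powers of [A].  By the separable
    part these [q]-th powers lie in [p'(theta)^-1 A[theta]], which is finite over
    the [q]-th powers of [A] as soon as [A] is; and for [A = F[X]] this holds
    because the finite field [F] is perfect ([finite_free_pow],
    [finite_free_integral_closure], [poly_frobenius_span]).

    Ring structure.  Once [B] is finite over [A], its ideals are finitely
    generated; integral closedness is transitivity of integrality; and nonzero
    primes are maximal because they contract to nonzero primes of [A], which are
    maximal ([integral_closure_dedekind]).

    Base rings.  The integers and [F[X]] are Euclidean, and canonical remainders
    give the exact norms [`|x|] and [#|F| ^ deg x], from which the conditions on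
    a basic PID are read off ([basic_PID_int], [basic_PID_poly]).

    In the function field case [K] is given as a finite extension of an abstract
    rational function field [F(s)].  As [t] is algebraic over [F(s)] but not over
    [F], the element [s] is algebraic over [F(t)], so [K] is also finite over
    [F(t)] ([finite_over_transcendental]), and can be rebuilt as an extension of
    that field ([scalars_along_ext]). *)

(** * Submodules of finite free modules over a principal ideal domain *)

Section Modules.
Variables (A R : idomainType) (f : {rmorphism A -> R}).

Definition lin_span (m : nat) (v : nat -> R) : set R :=
  [set x | exists c : nat -> A, x = \sum_(i < m) f (c i) * v i].

Definition lin_indep (m : nat) (v : nat -> R) :=
  forall c : nat -> A,
    \sum_(i < m) f (c i) * v i = 0 -> forall i, (i < m)%N -> c i = 0.

Record submodule (S : set R) : Prop := Submodule {
  submod0 : S 0;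
  submodD : forall x y, S x -> S y -> S (x + y);
  submodZ : forall a x, S x -> S (f a * x)
}.

Lemma submodB S x y : submodule S -> S x -> S y -> S (x - y).
Proof.
move=> Sm Sx Sy; apply: submodD => //; rewrite -mulN1r -(rmorph1 f) -rmorphN.
exact: submodZ.
Qed.

Lemma submod_sum S (m : nat) (F : nat -> R) : submodule S ->
  (forall i, (i < m)%N -> S (F i)) -> S (\sum_(i < m) F i).
Proof.
move=> Sm SF; elim/big_ind: _ => [|x y|i _]; first exact: submod0.
- exact: submodD.
- exact: SF.
Qed.

Lemma lin_span_submod m v : submodule (lin_span m v).
Proof.
split=> [|x y [c ->] [c' ->]|a x [c ->]].
- by exists (fun=> 0); rewrite big1 // => i _; rewrite rmorph0 mul0r.
- exists (fun i => c i + c' i); rewrite -big_split /=.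
  by apply: eq_bigr => i _; rewrite rmorphD mulrDl.
- exists (fun i => a * c i); rewrite mulr_sumr.
  by apply: eq_bigr => i _; rewrite rmorphM mulrA.
Qed.

Lemma mem_lin_span m v i : (i < m)%N -> lin_span m v (v i).
Proof.
move=> im; exists (fun j => (j == i)%:R).
rewrite (bigD1 (Ordinal im)) //= eqxx rmorph1 mul1r big1 ?addr0 // => j.
by rewrite -val_eqE /= => /negbTE->; rewrite rmorph0 mul0r.
Qed.

Lemma lin_spanS m v x :
  lin_span m.+1 v x -> exists a y, lin_span m v y /\ x = y + f a * v m.
Proof.
case=> c ->; exists (c m), (\sum_(i < m) f (c i) * v i).
by rewrite big_ord_recr; split=> //; exists c.
Qed.

Hypothesis A_PID : principal_ideal_domain A.

(** The induction removes the last vector.  Its coefficients on [S] form a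
    principal ideal, and an [s0] in [S] realizing the generator splits off a
    rank one complement to [S'], the part of [S] that avoids the last vector,
    unless a nonzero multiple of [s0] lies in [S']; in that case a multiple of
    [S] lies in the span of the first [m] vectors already.  The factor [d] is
    what allows a spanning family [v] with linear relations. *)
Lemma submodule_basis m v d S : d != 0 -> submodule S ->
    (forall s, S s -> lin_span m v (f d * s)) -> injective f ->
  exists n b, [/\ (n <= m)%N, forall i, (i < n)%N -> S (b i),
                  S `<=` lin_span n b & lin_indep n b].
Proof.
move=> d0 Sm Sv finj.
have f0 a : a != 0 -> f a != 0 by rewrite -(rmorph0 f) (inj_eq finj).
elim: m => [|m IHm] in v d S d0 Sm Sv *.
  exists 0%N, v; split=> // s /Sv[c]; rewrite big_ord0 => /eqP.
  rewrite mulf_eq0 (negbTE (f0 _ d0)) => /eqP->.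
  exact: submod0 (lin_span_submod _ _).
have spm := lin_span_submod m v.
pose I : set A := [set a | exists2 s, S s & lin_span m v (f d * s - f a * v m)].
have [|a0 Ia0] := A_PID (I := I).
  split.
  - exists 0; first exact: submod0.
    by rewrite rmorph0 mulr0 mul0r subrr; exact: submod0.
  - move=> a b [s Ss sa] [t St tb]; exists (s + t); first exact: submodD.
    have -> : f d * (s + t) - f (a + b) * v m =
      (f d * s - f a * v m) + (f d * t - f b * v m) by rewrite rmorphD; ring.
    exact: submodD.
  - move=> b a [s Ss sa]; exists (f b * s); first exact: submodZ.
    have -> : f d * (f b * s) - f (b * a) * v m = f b * (f d * s - f a * v m).
      by rewrite rmorphM; ring.
    exact: submodZ.
have IE a : I a -> exists r, a = r * a0 by rewrite Ia0 => -[r _ <-]; exists r.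
have [s0 Ss0 s0E] : I a0 by rewrite Ia0; exists 1; rewrite ?mul1r.
have coefS s : S s -> exists r, lin_span m v (f d * (s - f r * s0)).
  move=> Ss; have /lin_spanS[a [y [ym sE]]] := Sv _ Ss.
  have [|r aE] := IE a; first by exists s => //; rewrite sE addrK.
  exists r; have -> : f d * (s - f r * s0) = y - f r * (f d * s0 - f a0 * v m).
    by rewrite mulrBr sE aE rmorphM; ring.
  by apply: submodB => //; apply: submodZ.
have [[e e0 es0]|ns0] :=
    pselect (exists2 e, e != 0 & lin_span m v (f d * (f e * s0))).
  have [||s Ss|n [b [nm Sb sb ib]]] := IHm v (e * d) S.
  - by rewrite mulf_neq0.
  - by [].
  - have [r sr] := coefS _ Ss.
    have -> : f (e * d) * s =
        f e * (f d * (s - f r * s0)) + f r * (f d * (f e * s0)).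
      by rewrite rmorphM; ring.
    by apply: submodD => //; apply: submodZ.
  - by exists n, b; split=> //; apply: leqW.
pose S' : set R := [set s | S s /\ lin_span m v (f d * s)].
have S'm : submodule S'.
  split=> [|x y [Sx xm] [Sy ym]|a x [Sx xm]].
  - by split; rewrite ?mulr0; exact: submod0.
  - by split; rewrite ?mulrDr; apply: submodD.
  - by split; rewrite 1?mulrCA; apply: submodZ.
have [s []//|n [b [nm Sb sb ib]]] := IHm v d S' d0 S'm.
pose b' i := if i == n then s0 else b i.
have b'E (c : nat -> A) : \sum_(i < n.+1) f (c i) * b' i =
    \sum_(i < n) f (c i) * b i + f (c n) * s0.
  rewrite big_ord_recr /= /b' eqxx; congr (_ + _); apply: eq_bigr => i _.
  by rewrite ltn_eqF.
exists n.+1, b'; split=> //.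
- move=> i; rewrite ltnS leq_eqVlt /b'; case: eqP => //= _ /Sb[]//.
- move=> s Ss; have [r sr] := coefS _ Ss.
  have [|c cE] := sb (s - f r * s0).
    by split=> //; apply: submodB => //; apply: submodZ.
  exists (fun i => if i == n then r else c i).
  rewrite (b'E (fun i => if i == n then r else c i)) eqxx.
  rewrite -[LHS](subrK (f r * s0)) cE; congr (_ + _); apply: eq_bigr => i _.
  by rewrite ltn_eqF.
- move=> c; rewrite b'E => cE.
  have cn0 : c n = 0.
    apply/eqP/negP => /negP cn0; apply: ns0; exists (c n) => //.
    suff: S' (f (c n) * s0) by case.
    have -> : f (c n) * s0 = 0 - \sum_(i < n) f (c i) * b i.
      by apply/eqP; rewrite sub0r -addr_eq0 addrC cE.
    apply: submodB => //; first exact: submod0.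
    apply: (submod_sum (F := fun i => f (c i) * b i)) => // i /Sb.
    exact: submodZ.
  move=> i; rewrite ltnS leq_eqVlt => /predU1P[->//|]; apply: ib.
  by move: cE; rewrite cn0 rmorph0 mul0r addr0.
Qed.

End Modules.

(** * A common denominator for integral elements *)

Section PencilPolynomial.
Variables (A R : idomainType) (f : {rmorphism A -> R}).

(** Cayley-Hamilton for multiplication by [theta + x 'X] on the extension of [S]
    to [A['X]]: the polynomial is the characteristic polynomial of a pencil of
    matrices over [A], and it vanishes at [theta + x 'X] because the basis of
    [S] is an eigenvector. *)
Lemma pencil_charpoly (S : set R) n b theta x :
    submodule f S -> (forall i, (i < n)%N -> S (b i)) -> S `<=` lin_span f n b ->
    S 1 -> (forall s, S s -> S (theta * s)) -> (forall s, S s -> S (x * s)) ->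
  exists chi : {poly {poly A}}, [/\ chi \is monic, size chi = n.+1 &
    root (map_poly (map_poly f) chi) (theta%:P + x%:P * 'X)].
Proof.
move=> Sm Sb sb S1 St Sx.
have mulE y : (forall s, S s -> S (y * s)) ->
    exists P : nat -> nat -> A, forall i, (i < n)%N ->
      y * b i = \sum_(j < n) f (P i j) * b j.
  move=> Sy.
  have /choice[P PE] : forall i, exists c : nat -> A, (i < n)%N ->
      y * b i = \sum_(j < n) f (c j) * b j.
    move=> i; have [im|im] := boolP (i < n)%N; last by exists (fun=> 0).
    by have [c cE] := sb _ (Sy _ (Sb _ im)); exists c.
  by exists P.
have [P PE] := mulE _ St; have [Q QE] := mulE _ Sx.
pose M : 'M[{poly A}]_n := \matrix_(j, i) ((P i j)%:P + (Q i j)%:P * 'X).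
pose u := theta%:P + x%:P * 'X : {poly R}.
exists (char_poly M); rewrite char_poly_monic size_char_poly; split=> //.
pose g : {rmorphism {poly {poly A}} -> {poly R}} :=
  horner_eval u \o map_poly (map_poly f).
have gE p : (map_poly (map_poly f) p).[u] = g p by [].
rewrite /root -/u gE /char_poly -det_map_mx; apply/det0P.
exists (\row_i (b i)%:P).
  apply/eqP => b0; have [c cE] := sb _ S1.
  move/eqP: (oner_neq0 R); apply; rewrite cE big1 // => i _.
  by have /rowP/(_ i)/eqP := b0; rewrite !mxE polyC_eq0 => /eqP->; rewrite mulr0.
apply/rowP => i; rewrite !mxE.
have gM j : g (char_poly_mx M j i) =
    u *+ (j == i) - ((f (P i j))%:P + (f (Q i j))%:P * 'X).
  rewrite !mxE rmorphB rmorphMn /= /g /=.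
  rewrite map_polyX /horner_eval hornerX map_polyC hornerC /=.
  by rewrite rmorphD rmorphM /= map_polyX !map_polyC.
under eq_bigr => j _ do rewrite [X in X * _]mxE [X in _ * X]mxE gM mulrBr.
rewrite big_split /= sumrN (bigD1 i) //= eqxx mulr1n big1 ?addr0; last first.
  by move=> j /negbTE->; rewrite mulr0n mulr0.
apply/eqP; rewrite subr_eq0 /u mulrDr; apply/eqP.
have -> : (b i)%:P * theta%:P = \sum_(j < n) (b j)%:P * (f (P i j))%:P.
  rewrite -polyCM mulrC PE // rmorph_sum; apply: eq_bigr => j _.
  by rewrite /= polyCM mulrC.
have -> : (b i)%:P * (x%:P * 'X) =
    \sum_(j < n) (b j)%:P * ((f (Q i j))%:P * 'X).
  rewrite mulrA -polyCM [b i * x]mulrC QE // rmorph_sum mulr_suml.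
  by apply: eq_bigr => j _; rewrite /= polyCM mulrA [X in X * 'X]mulrC.
by rewrite -big_split; apply: eq_bigr => j _; rewrite mulrDr.
Qed.

Lemma map_poly_horner_span n (p : {poly A}) x : (size p <= n)%N ->
  lin_span f n (fun i => x ^+ i) (map_poly f p).[x].
Proof.
move=> pn; exists (fun i => p`_i); rewrite (@horner_coef_wide _ n).
  by apply: eq_bigr => i _; rewrite coef_map.
exact: leq_trans (size_poly _ _) pn.
Qed.

(** The polynomial [p] is the value of [chi] at ['X = 0]; differentiating the
    equation of [pencil_charpoly] there gives [x * p'(theta)] as a polynomial
    in [theta], of degree less than [n] because [chi] is monic. *)
Lemma pencil_deriv n (chi : {poly {poly A}}) theta x :
    chi \is monic -> size chi = n.+1 ->
    root (map_poly (map_poly f) chi) (theta%:P + x%:P * 'X) ->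
  exists p : {poly A}, [/\ p \is monic, size p = n.+1, root (map_poly f p) theta &
    lin_span f n (fun i => theta ^+ i) (x * (map_poly f p)^`().[theta])].
Proof.
move=> chim chin; set u := _ + _; set ff := map_poly f => /rootP chi0.
have uE : u.[0] = theta by rewrite /u !hornerE.
have du : u^`() = x%:P.
  by rewrite /u derivD derivC derivM derivC derivX mul0r mulr1 !add0r.
clearbody u.
pose p := map_poly (horner_eval 0) chi.
have pm : p \is monic by apply: monic_map.
have pE i : p`_i = chi`_i`_0 by rewrite coef_map /= /horner_eval horner_coef0.
have chiE : (map_poly ff chi).[u] = \sum_(i < n.+1) ff chi`_i * u ^+ i.
  rewrite (@horner_coef_wide _ n.+1); last by rewrite -chin size_poly.
  by apply: eq_bigr => i _; rewrite coef_map.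
have sp : size p = n.+1 by rewrite size_map_poly_id0 // (monicP chim) rmorph1 oner_eq0.
exists p; split=> //.
  apply/rootP; have := congr1 (horner_eval 0) chi0.
  rewrite chiE rmorph0 raddf_sum /= => <-.
  rewrite (@horner_coef_wide _ n.+1); last by rewrite -sp size_poly.
  apply: eq_bigr => i _; rewrite coef_map pE /= /horner_eval hornerM horner_exp uE.
  by rewrite horner_coef0 coef_map.
have fpE : map_poly f p = \sum_(i < n.+1) f chi`_i`_0 *: 'X^i.
  rewrite -(poly_def n.+1 (fun i => f chi`_i`_0)); apply/polyP => i.
  rewrite coef_map coef_poly /= pE.
  case: ltnP => // ni; rewrite (_ : chi`_i = 0) ?coef0 ?rmorph0 //.
  by rewrite nth_default ?chin.
have := congr1 (fun q => q^`().[0]) chi0; rewrite chiE deriv0 horner0.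
rewrite linear_sum horner_sum.
under eq_bigr => i _.
  rewrite /= derivM deriv_exp du !hornerE hornerMn !hornerE uE.
  rewrite !horner_coef0 coef_deriv !coef_map mulr1n /=.
  over.
(* The leading coefficient 1 of [chi] does not depend on the inner variable. *)
rewrite big_split /= big_ord_recr /=.
have -> : chi`_n = 1 by rewrite -(monicP chim) /lead_coef chin.
rewrite coef1 rmorph0 mul0r addr0 => /eqP; rewrite addrC addr_eq0 => /eqP xE.
have -> : x * (map_poly f p)^`().[theta] =
    - \sum_(i < n) f chi`_i`_1 * theta ^+ i.
  rewrite -xE fpE linear_sum horner_sum mulr_sumr; apply: eq_bigr => i _.
  rewrite /= derivZ derivXn !hornerE hornerMn !hornerE.
  by rewrite /= [x * _]mulrC -mulrA mulrnAr.
have [_ _ spZ] := lin_span_submod f n (fun i => theta ^+ i).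
rewrite -mulN1r -(rmorph1 f) -rmorphN; apply: spZ.
by exists (fun i => chi`_i`_1).
Qed.

End PencilPolynomial.

Section Conductor.
Variables (A R : idomainType) (f : {rmorphism A -> R}).
Hypotheses (finj : injective f) (A_PID : principal_ideal_domain A).
Variables (N : nat) (theta : R).

Local Notation pows := (fun i => theta ^+ i).

(** When the powers of [theta] are independent and the next power has a
    denominator too, these are the elements of [k(theta)], for [k] the fraction
    field of [A]. *)
Definition has_denom (y : R) :=
  exists2 d : A, d != 0 & lin_span f N pows (f d * y).

Hypotheses (thetaN : has_denom (theta ^+ N)) (theta_indep : lin_indep f N pows).

Let sp := lin_span_submod f N pows.

Lemma has_denom_submod : submodule f has_denom.
Proof.
split=> [|x y [d d0 dx] [e e0 ey]|a x [d d0 dx]].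
- by exists 1; rewrite ?oner_neq0 // mulr0; exact: submod0 sp.
- exists (d * e); first by rewrite mulf_neq0.
  have -> : f (d * e) * (x + y) = f e * (f d * x) + f d * (f e * y).
    by rewrite rmorphM; ring.
  by apply: (submodD sp); apply: (submodZ sp).
- by exists d => //; rewrite mulrCA; apply: (submodZ sp).
Qed.

Lemma has_denom_div d x : d != 0 -> has_denom (f d * x) -> has_denom x.
Proof.
move=> d0 [e e0 ex]; exists (e * d); first by rewrite mulf_neq0.
by rewrite rmorphM -mulrA.
Qed.

Lemma has_denom_span x : lin_span f N pows x -> has_denom x.
Proof. by exists 1; rewrite ?oner_neq0 // rmorph1 mul1r. Qed.

Lemma has_denom_mul_theta y : has_denom y -> has_denom (theta * y).
Proof.
case=> d d0 [c cE]; apply: (has_denom_div d0); rewrite mulrCA cE mulr_sumr.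
apply: (submod_sum (F := fun i => theta * (f (c i) * theta ^+ i)))
  => [|i iN]; first exact: has_denom_submod.
rewrite mulrCA -exprS; apply: (submodZ has_denom_submod).
move: iN; rewrite leq_eqVlt => /predU1P[->//|iN].
exact/has_denom_span/(mem_lin_span f pows).
Qed.

Lemma has_denom1 : has_denom 1.
Proof.
case: (posnP N) thetaN => [->//|N0 _].
exact/has_denom_span/(mem_lin_span f pows N0).
Qed.

Lemma has_denom_mul x y : has_denom x -> has_denom y -> has_denom (x * y).
Proof.
case=> d d0 [c cE] yd; apply: (has_denom_div d0); rewrite mulrA cE mulr_suml.
apply: (submod_sum (F := fun i => f (c i) * theta ^+ i * y)) => [|i _].
  exact: has_denom_submod.
rewrite -mulrA; apply: (submodZ has_denom_submod).
elim: i => [|i IHi]; first by rewrite mul1r.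
by rewrite exprS -mulrA; apply: has_denom_mul_theta.
Qed.

Lemma has_denom_exp x i : has_denom x -> has_denom (x ^+ i).
Proof.
move=> xd; elim: i => [|i IHi]; first exact: has_denom1.
by rewrite exprS; apply: has_denom_mul.
Qed.

Lemma common_denom (n : nat) (v : nat -> R) :
    (forall i, (i < n)%N -> has_denom (v i)) ->
  exists2 d : A, d != 0 &
    forall i, (i < n)%N -> lin_span f N pows (f d * v i).
Proof.
elim: n => [|n IHn] vd; first by exists 1; rewrite ?oner_neq0.
have [i ni|d d0 dv] := IHn; first exact/vd/leqW.
have [e e0 ev] := vd n (leqnn _).
exists (d * e) => [|i]; first by rewrite mulf_neq0.
rewrite ltnS leq_eqVlt rmorphM => /predU1P[->|/dv].
  by rewrite -mulrA; apply: (submodZ sp).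
by rewrite -mulrA mulrCA; apply: (submodZ sp).
Qed.

(** Euclidean division by a monic polynomial makes sense over any ring. *)
Lemma monic_rmodp (B : comNzRingType) (g : {rmorphism B -> R}) (p q : {poly B}) x :
    p \is monic -> root (map_poly g p) x ->
  exists2 r : {poly B}, (size r < size p)%N &
    (map_poly g q).[x] = (map_poly g r).[x].
Proof.
move=> pm /rootP p0; exists (Pdiv.Ring.rmodp q p).
  by rewrite Pdiv.Ring.ltn_rmodpN0 // monic_neq0.
rewrite [in LHS](Pdiv.RingMonic.rdivp_eq pm q) rmorphD rmorphM /=.
by rewrite !hornerE p0 mulr0 add0r.
Qed.

(** The ring [A[theta, x]], which is finite over [A] by integrality and has
    bounded denominators. *)
Lemma integral_pair_module x :
    integralOver f theta -> integralOver f x -> has_denom x ->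
  exists S : set R, [/\ submodule f S, S 1,
    forall s, S s -> S (theta * s), forall s, S s -> S (x * s) &
    exists2 d, d != 0 & forall s, S s -> lin_span f N pows (f d * s)].
Proof.
move=> [p pm p0] [q qm q0] xd.
have thetad : has_denom theta.
  by rewrite -[theta]mulr1; exact/has_denom_mul_theta/has_denom1.
pose g : {rmorphism {poly A} -> R} := horner_eval theta \o map_poly f.
pose h : {rmorphism {poly {poly A}} -> R} := horner_eval x \o map_poly g.
have hC a : h a%:P%:P = f a.
  rewrite /h /= map_polyC /horner_eval hornerC /g /= map_polyC.
  by rewrite /horner_eval hornerC.
have hX : h 'X = x by rewrite /h /= map_polyX /horner_eval hornerX.
have hY : h 'X%:P = theta.
  rewrite /h /= map_polyC /horner_eval hornerC /g /= map_polyX.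
  by rewrite /horner_eval hornerX.
exists (range h); split.
- split; first by exists 0; rewrite ?rmorph0.
    by move=> _ _ [P _ <-] [Q _ <-]; exists (P + Q); rewrite ?rmorphD.
  by move=> a _ [P _ <-]; exists (a%:P%:P * P); rewrite ?rmorphM ?hC.
- by exists 1; rewrite ?rmorph1.
- by move=> _ [P _ <-]; exists ('X%:P * P); rewrite ?rmorphM ?hY.
- by move=> _ [P _ <-]; exists ('X * P); rewrite ?rmorphM ?hX.
set m := size p; set n := size q.
(* The products of powers, listed in lexicographic order of the exponents. *)
pose v k := theta ^+ (k %/ n) * x ^+ (k %% n).
have [|d d0 dv] := @common_denom (m * n) v.
  by move=> i _; apply: has_denom_mul; apply: has_denom_exp.
exists d => // _ [P _ <-].
have q'm : map_poly polyC q \is monic by exact: monic_map.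
have [|r rq hP] := @monic_rmodp _ g (map_poly polyC q) P x q'm.
  rewrite -map_poly_comp (@eq_map_poly _ _ _ f) // => a /=.
  by rewrite /g /= map_polyC /horner_eval hornerC.
rewrite -[h P]/((map_poly g P).[x]) hP.
have {}rq : (size r <= n)%N by rewrite ltnW // (leq_trans rq) // size_poly.
rewrite (@horner_coef_wide _ n); last by rewrite (leq_trans _ rq) // size_poly.
rewrite mulr_sumr.
apply: (submod_sum (F := fun j => f d * ((map_poly g r)`_j * x ^+ j)) sp) => j jn.
have [r' r'p gr] := @monic_rmodp _ f p r`_j theta pm p0.
rewrite (_ : (map_poly g r)`_j = (map_poly f r`_j).[theta]) ?gr; last first.
  by rewrite coef_map.
rewrite (@horner_coef_wide _ m); last first.
  by rewrite (leq_trans (size_poly _ _)) // ltnW.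
rewrite mulr_suml mulr_sumr.
apply: (submod_sum (F := fun i =>
  f d * ((map_poly f r')`_i * theta ^+ i * x ^+ j)) sp) => i im.
rewrite coef_map -mulrA mulrCA; apply: (submodZ sp).
have := dv (i * n + j)%N; rewrite /v.
rewrite divnMDl ?(leq_ltn_trans _ jn) // divn_small // addn0.
rewrite modnMDl modn_small //; apply.
by rewrite (@leq_trans (i * n + n)) ?ltn_add2l // -mulSnr leq_mul2r im orbT.
Qed.

Lemma root_lin_indep (p : {poly A}) :
  (size p <= N)%N -> root (map_poly f p) theta -> p = 0.
Proof.
move=> pN /rootP p0; apply/polyP => i; rewrite coef0.
have [iN|Ni] := ltnP i N; last by rewrite nth_default // (leq_trans pN).
apply: (theta_indep (c := fun i => p`_i)) => //.
rewrite -[RHS]p0 (@horner_coef_wide _ N); last first.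
  exact: leq_trans (size_poly _ _) pN.
by apply: eq_bigr => j _; rewrite coef_map.
Qed.

(** The element [p'(theta)] is a denominator common to all integral elements of
    [k(theta)], which is what bounds their ring from above.  For each [x] the
    polynomial comes from a basis of [A[theta, x]] of some size [n <= N]; it
    kills [theta], so independence forces [n = N] and makes it the same
    polynomial for all [x]. *)
Lemma integral_conductor : integralOver f theta ->
  exists p : {poly A}, [/\ p \is monic, size p = N.+1, root (map_poly f p) theta &
    forall x, integralOver f x -> has_denom x ->
      lin_span f N pows (x * (map_poly f p)^`().[theta])].
Proof.
move=> it.
have main x : integralOver f x -> has_denom x -> exists p : {poly A},
   [/\ p \is monic, size p = N.+1, root (map_poly f p) theta &
    lin_span f N pows (x * (map_poly f p)^`().[theta])].
  move=> ix xd.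
  have [S [Sm S1 St Sx [d d0 dS]]] := integral_pair_module it ix xd.
  have [n [b [nN Sb sb ib]]] := submodule_basis A_PID d0 Sm dS finj.
  have [chi [chim chis chi0]] := pencil_charpoly Sm Sb sb S1 St Sx.
  have [p [pm ps p0 px]] := pencil_deriv chim chis chi0.
  suff nE : n = N by exists p; rewrite -nE.
  apply/eqP; rewrite eqn_leq nN leqNgt /=; apply/negP => ltnN.
  by have := monic_neq0 pm; rewrite (root_lin_indep _ p0) ?eqxx ?ps.
have [p [pm ps p0 _]] := main 1 (integral1 f) has_denom1.
exists p; split=> // x ix xd; have [q [qm qs q0]] := main x ix xd.
suff -> : q = p by [].
apply/eqP; rewrite -subr_eq0; apply/eqP/root_lin_indep; last first.
  by rewrite /root rmorphB hornerD hornerN (rootP p0) (rootP q0) subrr.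
apply/leq_sizeP => j; rewrite coefB leq_eqVlt => /predU1P[<-|Nj].
  have := monicP pm; have := monicP qm; rewrite /lead_coef ps qs /= => -> ->.
  by rewrite subrr.
by rewrite !nth_default ?subr0 ?ps ?qs.
Qed.

End Conductor.

(** * Descent along a power of the Frobenius morphism *)

Section PowerMorphism.
Variables (A K : comNzRingType) (f : {rmorphism A -> K}) (q : nat).
Hypothesis expB : forall x y : K, (x - y) ^+ q = x ^+ q - y ^+ q.

Definition pow_map (a : A) : K := f a ^+ q.

Let pow_map_zmod_morphism : zmod_morphism pow_map.
Proof. by move=> a b; rewrite /pow_map rmorphB expB. Qed.

Let pow_map_monoid_morphism : monoid_morphism pow_map.
Proof. by split=> [|a b]; rewrite /pow_map ?rmorph1 ?expr1n // rmorphM exprMn. Qed.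

Definition pow_rmorphism : {rmorphism A -> K} :=
  HB.pack pow_map
    (GRing.isZmodMorphism.Build _ _ pow_map pow_map_zmod_morphism)
    (GRing.isMonoidMorphism.Build _ _ pow_map pow_map_monoid_morphism).

End PowerMorphism.

Lemma icval_sum (A : comNzRingType) (K : fieldType) (f : {rmorphism A -> K}) n
    (c : 'I_n -> A) (b : 'I_n -> integral_closure f) :
  icval (\sum_(i < n) ic_map f (c i) * b i) = \sum_(i < n) f (c i) * icval (b i).
Proof. by rewrite -[LHS]/(val _) raddf_sum. Qed.

Section FiniteFree.
Variables (A : idomainType) (K : fieldType) (f : {rmorphism A -> K}).
Hypotheses (finj : injective f) (A_PID : principal_ideal_domain A).
Variables (N : nat) (theta : K) (q : nat).
Hypotheses (thetaN : has_denom f N theta (theta ^+ N))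
  (theta_indep : lin_indep f N (fun i => theta ^+ i))
  (theta_int : integralOver f theta)
  (theta_sep : forall p : {poly A}, p \is monic -> size p = N.+1 ->
     root (map_poly f p) theta -> (map_poly f p)^`().[theta] != 0)
  (expB : forall x y : K, (x - y) ^+ q = x ^+ q - y ^+ q)
  (q_gt0 : (0 < q)%N)
  (K_pow : forall y : K, has_denom f N theta (y ^+ q)).
Variables (r : nat) (g : nat -> A).
Hypothesis A_pow : forall a, exists c : nat -> A, a = \sum_(j < r) c j ^+ q * g j.

(** The map [y |-> y ^+ q] identifies [B], as an [A]-module, with its set [S] of
    [q]-th powers, where [A] acts through [q]-th powers.  By the conductor, [S]
    lies in the span of the [g j * theta ^+ i / p'(theta)]. *)
Lemma finite_free_pow : finite_free_module (ic_map f).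
Proof.
have [p [pm ps p0 pD]] := integral_conductor finj A_PID thetaN theta_indep theta_int.
have := theta_sep pm ps p0; set D := _.[theta] in pD *; move=> D0.
have exp_inj : injective (fun x : K => x ^+ q).
  by move=> x y /= /eqP; rewrite -subr_eq0 -expB expf_eq0 q_gt0 subr_eq0 => /eqP.
have psiE a : pow_rmorphism f expB a = f a ^+ q by [].
have exp0 : (0 : K) ^+ q = 0 by rewrite expr0n gtn_eqF.
have expD (x y : K) : (x + y) ^+ q = x ^+ q + y ^+ q.
  have expN : (- y) ^+ q = - y ^+ q by rewrite -sub0r expB exp0 sub0r.
  by rewrite -[y in LHS]opprK expB expN opprK.
have exp_sum n (F : nat -> K) : (\sum_(i < n) F i) ^+ q = \sum_(i < n) F i ^+ q.
  by apply: (big_morph (fun x : K => x ^+ q)).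
pose S : set K := [set y ^+ q | y in integralOver f].
have Sm : submodule (pow_rmorphism f expB) S.
  split.
  - by exists 0 => //; exact: integral0.
  - by move=> _ _ [x ix <-] [y iy <-]; exists (x + y) => //; exact: integral_add.
  - move=> a _ [x ix <-]; exists (f a * x); last by rewrite psiE exprMn.
    by apply: integral_mul => //; exact: integral_id.
(* The pairs (i, j) with i < N and j < r, listed in lexicographic order. *)
pose v k := f (g (k %% r)) * theta ^+ (k %/ r) / D.
have [||n [b [_ Sb sb ib]]] :=
    submodule_basis A_PID (m := N * r) (v := v) (oner_neq0 A) Sm.
- move=> _ [y iy <-]; rewrite rmorph1 mul1r.
  have [|c cE] := pD (y ^+ q) _ (K_pow y).
    by elim: (q) => [|i IHi]; [exact: integral1 | rewrite exprS; exact: integral_mul].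
  have -> : y ^+ q = \sum_(i < N) f (c i) * theta ^+ i / D.
    by rewrite -mulr_suml -cE mulfK.
  have spm := lin_span_submod (pow_rmorphism f expB) (N * r) v.
  apply: (submod_sum (F := fun i => f (c i) * theta ^+ i / D) spm) => i iN.
  have [e ->] := A_pow (c i); rewrite rmorph_sum 2!mulr_suml.
  apply: (submod_sum (F := fun j => f (e j ^+ q * g j) * theta ^+ i / D) spm) => j jr.
  have -> : f (e j ^+ q * g j) * theta ^+ i / D =
     pow_rmorphism f expB (e j) * v (i * r + j)%N.
    rewrite psiE /v divnMDl ?(leq_ltn_trans _ jr) // divn_small // addn0.
    by rewrite modnMDl modn_small // rmorphM rmorphXn !mulrA.
  apply: (submodZ spm); apply: mem_lin_span.
  by rewrite (@leq_trans (i * r + r)) ?ltn_add2l // -mulSnr leq_mul2r iN orbT.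
- by move=> a a' /exp_inj/finj.
have /choice[beta betaP] : forall i, exists y, integralOver f y /\
    ((i < n)%N -> b i = y ^+ q).
  move=> i; have [/Sb[y iy <-]|_] := boolP (i < n)%N; first by exists y.
  by exists 0; split=> //; exact: integral0.
have bi i : beta i \in integral_pred f by apply/asboolP; case: (betaP i).
have bE i : (i < n)%N -> b i = beta i ^+ q by case: (betaP i).
exists n, (fun i : 'I_n => IntegralClosure (bi i)); split.
  move=> x; have [|c cE] := sb (icval x ^+ q).
    by exists (icval x) => //; exact/asboolP/(valP x).
  exists (fun i => c i); apply/val_inj/exp_inj => /=.
  rewrite cE icval_sum (exp_sum n (fun i => f (c i) * beta i)).
  by apply: eq_bigr => i _; rewrite exprMn bE.
move=> c /(congr1 (fun z => icval z ^+ q)); rewrite icval_sum exp0.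
pose c' i := oapp c 0 (insub i).
have c'E (i : 'I_n) : c' i = c i by rewrite /c' valK.
under eq_bigr => i _ do rewrite -c'E.
rewrite (exp_sum n (fun i => f (c' i) * beta i)) => c0 i.
rewrite -c'E; apply: (ib c') => //; rewrite -[RHS]c0.
by apply: eq_bigr => j _; rewrite exprMn bE.
Qed.

End FiniteFree.

(** * Finiteness of integral closures in finite extensions *)

(** With [d] the leading coefficient and [n] the degree, [d ^+ n.-1] times the
    equation of [x] is a monic equation for [d * x]. *)
Lemma integral_lead_mul (A R : comNzRingType) (f : {rmorphism A -> R})
    (p : {poly A}) (x : R) :
  root (map_poly f p) x -> (1 < size p)%N -> integralOver f (f (lead_coef p) * x).
Proof.
move=> /rootP p0 p1; set d := lead_coef p; set n := (size p).-1.
have sp : size p = n.+1 by rewrite /n prednK // ltnW.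
have n0 : (0 < n)%N by rewrite -ltnS -sp.
pose F i := if i == n then 1 else p`_i * d ^+ (n.-1 - i).
exists (\poly_(i < n.+1) F i).
  by rewrite monicE lead_coefE size_poly_eq /F ?eqxx ?oner_neq0 // coef_poly ltnSn eqxx.
apply/rootP; rewrite (@horner_coef_wide _ n.+1); last first.
  by rewrite (leq_trans (size_poly _ _)) // size_poly.
transitivity (f d ^+ n.-1 * (map_poly f p).[x]); last by rewrite p0 mulr0.
rewrite (@horner_coef_wide _ n.+1) -?sp ?size_poly // sp mulr_sumr.
apply: eq_bigr => i _; rewrite !coef_map coef_poly ltn_ord /F /=.
rewrite exprMn; have [->|ni] := eqVneq (i : nat) n.
  have -> : p`_n = d by rewrite /d lead_coefE sp.
  by rewrite rmorph1 mul1r [RHS]mulrA -exprSr prednK.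
have lin : (i <= n.-1)%N.
  by rewrite -ltnS prednK // ltn_neqAle ni -ltnS ltn_ord.
by rewrite rmorphM rmorphXn -[in RHS](subnK lin) exprD; ring.
Qed.

Section FieldExtension.
Variables (A : idomainType) (k : fieldType) (iota : {rmorphism A -> k}).
Hypotheses (iota_inj : injective iota)
  (frac : forall z : k, exists2 b, b != 0 & exists a, iota b * z = iota a).
Variables (K : fieldExtType k) (f : {rmorphism A -> K}).
Hypothesis fE : forall a, f a = (iota a)%:A.

Lemma common_denom_frac n (c : nat -> k) :
  exists2 d : A, d != 0 &
    exists e : nat -> A, forall i, (i < n)%N -> iota d * c i = iota (e i).
Proof.
elim: n => [|n [d d0 [e de]]]; first by exists 1; rewrite ?oner_neq0 //; exists (fun=> 0).
have [b b0 [a ba]] := frac (c n).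
exists (d * b); first by rewrite mulf_neq0.
exists (fun i => if i == n then d * a else b * e i) => i.
rewrite ltnS leq_eqVlt rmorphM => /predU1P[->|ltin].
  by rewrite eqxx -mulrA ba rmorphM.
by rewrite ltn_eqF // rmorphM -de // mulrCA mulrA.
Qed.

Lemma fieldext_finj : injective f.
Proof. by move=> a b; rewrite !fE => /(fmorph_inj (in_alg K))/iota_inj. Qed.

Lemma Fadjoin_has_denom theta y : y \in <<1; theta>>%VS ->
  has_denom f (adjoin_degree 1 theta) theta y.
Proof.
set N := adjoin_degree _ _ => yt.
have /polyOver1P[p pE] := Fadjoin_polyOver 1 theta y.
have [d d0 [e de]] := common_denom_frac N (fun i => p`_i).
exists d => //; exists e; rewrite -[y in LHS](Fadjoin_poly_eq yt).
rewrite (@horner_coef_wide _ N) ?size_Fadjoin_poly // mulr_sumr.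
apply: eq_bigr => i _; rewrite pE coef_map /= mulrA; congr (_ * _).
by rewrite !fE -de // -[RHS]/(in_alg K _) rmorphM.
Qed.

Lemma Fadjoin_lin_indep theta :
  lin_indep f (adjoin_degree 1 theta) (fun i => theta ^+ i).
Proof.
set N := adjoin_degree _ _ => c c0 i iN.
pose p := \poly_(j < N) c j.
have pE : map_poly f p = map_poly (in_alg K) (map_poly iota p).
  by rewrite -map_poly_comp; apply: eq_map_poly => a /=; rewrite fE.
have : map_poly f p == 0.
  rewrite -(@root_small_adjoin_poly _ _ 1%AS theta).
  - apply/rootP; rewrite -[RHS]c0 (@horner_coef_wide _ N); last first.
      by rewrite (leq_trans (size_poly _ _)) // size_poly.
    by apply: eq_bigr => j _; rewrite coef_map coef_poly ltn_ord.
  - by rewrite pE; exact: alg_polyOver.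
  - by rewrite (leq_trans (size_poly _ _)) // size_poly.
move=> /eqP/polyP/(_ i); rewrite coef0 coef_map coef_poly iN /=.
by rewrite -(rmorph0 f) => /fieldext_finj.
Qed.

Lemma algebraic_over_subring (x : K) :
  exists q : {poly A}, (1 < size q)%N /\ root (map_poly f q) x.
Proof.
have /polyOver1P[p pE] := minPolyOver 1 x.
have sp : size p = (adjoin_degree 1 x).+1.
  by rewrite -(size_minPoly 1 x) pE size_map_poly.
have [d d0 [e de]] := common_denom_frac (size p) (fun i => p`_i).
pose q := \poly_(i < size p) e i.
have qE : map_poly f q = map_poly (in_alg K) (iota d *: p).
  apply/polyP => i; rewrite !coef_map coef_poly coefZ /=.
  case: ltnP => [ip|pi]; first by rewrite fE de.
  by rewrite nth_default // mulr0 scale0r rmorph0.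
have d'0 : iota d != 0 by rewrite -(rmorph0 iota) (inj_eq iota_inj).
exists q; split; last first.
  by rewrite qE map_polyZ rootZ ?fmorph_eq0 // -pE root_minPoly.
rewrite size_poly_eq ?sp ?ltnS ?lt0n //; apply/eqP => ed0.
have := de (size p).-1; rewrite sp ltnSn ed0 rmorph0 => /(_ isT)/eqP.
rewrite mulf_eq0 (negbTE d'0) /=; apply/negP.
have -> : adjoin_degree 1 x = (size p).-1 by rewrite sp.
by rewrite -lead_coefE lead_coef_eq0 -size_poly_eq0 sp.
Qed.

(** A generator of the maximal separable subextension, made integral by a
    scalar multiplication that does not change the field it generates. *)
Lemma separable_generator_integral :
  exists theta : K, [/\ integralOver f theta, separable_element 1 theta &
    purely_inseparable <<1; theta>> {:K}].
Proof.
have [x [_ sepx] insx] := separable_inseparable_decomposition {:K} 1.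
have [q [q1 q0]] := algebraic_over_subring x.
set b := lead_coef q; have b0 : iota b != 0.
  by rewrite -(rmorph0 iota) (inj_eq iota_inj) lead_coef_eq0 -size_poly_gt0 ltnW.
have fb0 : f b != 0 by rewrite fE scaler_eq0 (negbTE b0) oner_eq0.
have tx : f b * x \in <<1; x>>%VS.
  by rewrite fE mulr_algl memvZ // memv_adjoin.
exists (f b * x); split.
- exact: integral_lead_mul.
- exact: (adjoin_separableP sepx).
- suff sub : (<<1; x>> <= <<1; f b * x>>)%VS.
    apply/purely_inseparableP => y /(purely_inseparableP insx).
    exact: sub_inseparable.
  apply/FadjoinP; rewrite sub1v; split=> //.
  have xE : x = (iota b)^-1 *: (f b * x).
    by rewrite fE mulr_algl scalerA mulVf // scale1r.
  by rewrite [X in X \in _]xE memvZ // memv_adjoin.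
Qed.

(** A power of the characteristic that works for a basis of [K] works for all
    of [K], because the Frobenius powers are additive. *)
Lemma uniform_inseparable_exponent (E : {subfield K}) :
    purely_inseparable E {:K} ->
  exists2 q, [pchar K].-nat q & forall y : K, y ^+ q \in E.
Proof.
move=> ins.
have /choice[n nP] : forall y : K, exists n, [pchar K].-nat n && (y ^+ n \in E).
  move=> y; have /purely_inseparable_elementP_pchar[n pn yn] :=
    purely_inseparableP ins y (memvf y).
  by exists n; rewrite pn yn.
pose e := vbasis {:K}; pose q := (\prod_(i < \dim {:K}) n (e`_i)%R)%N.
have qn : [pchar K].-nat q.
  rewrite /q; elim/big_ind: _ => [//|a b|i _]; first by rewrite pnatM => -> ->.
  by have /andP[] := nP (e`_i).
exists q => // y; rewrite (coord_vbasis (memvf y)).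
rewrite (big_morph (fun x : K => x ^+ q) (id1 := 0) (op1 := +%R)); first last.
- by case/andP: qn => q0 _; rewrite expr0n gtn_eqF.
- by move=> x z; exact: exprDn_pchar.
apply: memv_suml => i _; rewrite exprZn memvZ //.
rewrite /q (bigD1 i) //= exprM rpredX //.
by have /andP[] := nP (e`_i).
Qed.

Hypothesis A_PID : principal_ideal_domain A.
(** This is what keeps the integral closure finite when [K] is inseparable over
    [k]; for a general principal ideal domain it may fail to be finite then. *)
Hypothesis A_pow : forall q, [pchar A].-nat q ->
  exists r (g : nat -> A), forall a, exists c : nat -> A,
    a = \sum_(j < r) c j ^+ q * g j.

(** The maximal separable subextension is handled by the conductor, and the
    purely inseparable remainder by a power of the Frobenius morphism. *)
Theorem finite_free_integral_closure : finite_free_module (ic_map f).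
Proof.
have [theta [it sept inst]] := separable_generator_integral.
have [q qn Kq] := uniform_inseparable_exponent inst.
have [|r [g gP]] := A_pow (q := q).
  have := qn; rewrite (eq_pnat _ (fmorph_pchar (in_alg K))).
  apply: sub_in_pnat => p _; rewrite !inE => /andP[-> /eqP p0] /=.
  by rewrite -(inj_eq iota_inj) rmorph_nat rmorph0 p0.
apply: (@finite_free_pow A K f fieldext_finj A_PID (adjoin_degree 1 theta) theta q).
- by apply: Fadjoin_has_denom; rewrite rpredX // memv_adjoin.
- exact: Fadjoin_lin_indep.
- exact: it.
- move=> p pm ps p0.
  suff -> : map_poly f p = minPoly 1 theta.
    by have := separable_root_der 1%AS theta; rewrite sept.
  have fpm : map_poly f p \is monic by exact: monic_map.
  apply/esym/eqP; rewrite -eqp_monic ?monic_minPoly //.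
  rewrite -dvdp_size_eqp; last first.
    apply: minPoly_dvdp p0.
    have -> : map_poly f p = map_poly (in_alg K) (map_poly iota p).
      by rewrite -map_poly_comp; apply: eq_map_poly => a /=; rewrite fE.
    exact: alg_polyOver.
  by rewrite size_minPoly size_map_poly_id0 ?ps // (monicP pm) rmorph1 oner_eq0.
- by move=> x y; rewrite exprDn_pchar // exprNn_pchar.
- by case/andP: qn.
- by move=> y; apply: Fadjoin_has_denom; exact: Kq.
- exact: gP.
Qed.

End FieldExtension.

(** * Integral closures that are finite over the base are Dedekind *)

Lemma fraction_reprE (R : idomainType) (z : {fraction R}) :
  FracField.tofrac (\d_(repr z)) * z = FracField.tofrac (\n_(repr z)).
Proof.
rewrite -[z in LHS]reprK; set x := repr z.
unlock FracField.tofrac; rewrite -[LHS]FracField.pi_mul /FracField.mulf.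
apply/eqmodP; rewrite /= FracField.equivfE.
rewrite !numden_Ratio ?mulf_neq0 ?oner_neq0 ?denom_ratioP //.
by rewrite mul1r mulr1 reprK mulrC.
Qed.

Lemma fraction_repr (R : idomainType) (z : {fraction R}) :
  exists2 b : R, b != 0 & exists a, FracField.tofrac b * z = FracField.tofrac a.
Proof.
exists (\d_(repr z)); first exact: denom_ratioP.
by exists (\n_(repr z)); exact: fraction_reprE.
Qed.

(** An equation for the fraction [a / b] is equivalent to a relation between [a]
    and [b] in [R], hence can be moved from one field containing [R] to
    another. *)
Lemma homogenize_horner (R : comNzRingType) (F : comNzRingType) (g : {rmorphism R -> F})
    (p : {poly R}) n a b z : size p = n.+1 -> g b * z = g a ->
  g b ^+ n * (map_poly g p).[z] = g (\sum_(i < n.+1) p`_i * a ^+ i * b ^+ (n - i)).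
Proof.
move=> sp bz; rewrite (@horner_coef_wide _ n.+1) -?sp ?size_poly // sp.
rewrite mulr_sumr rmorph_sum; apply: eq_bigr => i _.
rewrite coef_map !rmorphM !rmorphXn /= -bz exprMn.
have -> : g b ^+ n = g b ^+ (n - i) * g b ^+ i by rewrite -exprD subnK // -ltnS.
ring.
Qed.

Section Dedekind.
Variables (A : idomainType) (K : fieldType) (f : {rmorphism A -> K}).
Hypotheses (finj : injective f) (A_PID : principal_ideal_domain A).
Hypothesis ff : finite_free_module (ic_map f).
Local Notation B := (integral_closure f).
Local Notation phi := (ic_map f).

Lemma ic_map_inj : injective phi.
Proof. by move=> a b /(congr1 val)/finj. Qed.

(** Ideals are [A]-submodules of a free module of finite rank, and a basis over
    [A] generates them over [B]. *)
Lemma integral_closure_noetherian : noetherian B.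
Proof.
move=> I [I0 ID IZ]; have [n [b [gb _]]] := ff.
pose b' i := oapp b 0 (insub i).
have b'E (i : 'I_n) : b' i = b i by rewrite /b' valK.
have [|s _||m [v [_ Iv sv _]]] :=
    submodule_basis A_PID (f := phi) (m := n) (v := b') (S := I) (oner_neq0 A).
- by split=> // a x; apply: IZ.
- rewrite rmorph1 mul1r; have [c ->] := gb s.
  exists (fun i => oapp c 0 (insub i)); apply: eq_bigr => i _.
  by rewrite b'E valK.
- exact: ic_map_inj.
exists (mkseq v m); apply/seteqP; split=> x.
  move=> /sv[c ->]; exists (fun i => phi (c i)).
  by rewrite size_mkseq; apply: eq_bigr => i _; rewrite nth_mkseq.
case=> c ->; elim/big_ind: _ => [//|y z|i _]; first exact: ID.
apply: IZ; have := ltn_ord i; rewrite {2}size_mkseq => im.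
by rewrite nth_mkseq //; exact: Iv.
Qed.

(** The integral equation of [z] is moved from the fraction field of [B] to
    [K], where integrality is transitive. *)
Lemma integral_closure_integrally_closed : integrally_closed B.
Proof.
move=> z [p pm /rootP p0].
have [b b0 [a bz]] := fraction_repr z.
have valb0 : val b != 0 by rewrite (inj_eq val_inj b 0).
pose w := val a / val b.
have bw : val b * w = val a by rewrite mulrC divfK.
have sp : size p = (size p).-1.+1 by rewrite prednK // size_poly_gt0 monic_neq0.
have := homogenize_horner sp bz; rewrite p0 mulr0 => /esym/eqP.
rewrite tofrac_eq0 => /eqP h0.
have := homogenize_horner (g := val : {rmorphism B -> K}) sp bw.
rewrite h0 rmorph0 => /eqP; rewrite mulf_eq0 expf_eq0 (negbTE valb0) andbF /= => /eqP w0.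
have wi : w \in integral_pred f.
  apply/asboolP; apply: (@integral_root_monic _ _ f _ (map_poly val p)).
  - exact: monic_map.
  - exact/rootP.
  - apply/integral_poly => i; rewrite coef_map /=; exact/asboolP/(valP p`_i).
exists (IntegralClosure wi).
have tb0 : FracField.tofrac b != 0 by rewrite tofrac_eq0.
apply: (mulfI tb0); rewrite bz -tofracM; congr FracField.tofrac.
by apply: val_inj; rewrite /= -bw.
Qed.

Lemma ic_integral (x : B) : exists2 g : {poly A},
  g \is monic & (map_poly phi g).[x] = 0.
Proof.
have /asboolP[g gm /rootP g0] := valP x; exists g => //.
apply: val_inj => /=; rewrite -[LHS]/(val _) -horner_map -[RHS]g0.
by rewrite -map_poly_comp.
Qed.

Lemma monicMXaddC (p : {poly A}) c : p != 0 -> p * 'X + c%:P \is monic -> p \is monic.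
Proof.
move=> p0; rewrite !monicE lead_coefDl ?lead_coefMX //.
by rewrite size_mulX // (leq_ltn_trans (size_polyC_leq1 c)) // ltnS size_poly_gt0.
Qed.

Lemma horner_MXaddC_ic (p : {poly A}) c (x : B) :
  (map_poly phi (p * 'X + c%:P)).[x] = (map_poly phi p).[x] * x + phi c.
Proof. by rewrite rmorphD rmorphM /= map_polyX map_polyC !hornerE. Qed.

(** For a nonzero [y] in [P], the constant term of a monic equation of [y] is a
    multiple of [y]; if it is zero, the equation can be divided by [y]. *)
Lemma prime_ideal_contraction_neq0 (P : set B) :
  prime_ideal P -> P != [set 0] -> exists2 c : A, c != 0 & P (phi c).
Proof.
move=> [[P0 PD PZ] _ _] Pn0.
have [y [Py y0]] : exists y, P y /\ y != 0.
  apply: contrapT => nP; move/eqP: Pn0; apply; apply/seteqP; split=> y; last by move->.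
  by move=> Py; apply/eqP; apply: contrapT => /negP y0; apply: nP; exists y.
have [g gm g0] := ic_integral y.
elim/poly_ind: g gm g0 => [|p c IHp] gm.
  by rewrite monicE lead_coef0 eq_sym oner_eq0 in gm.
rewrite horner_MXaddC_ic; have [c0|c0 /eqP] := eqVneq c 0; last first.
  rewrite addrC addr_eq0 -mulNr => /eqP cE.
  by exists c; rewrite // cE; apply: PZ.
rewrite c0 rmorph0 addr0 => /eqP; rewrite mulf_eq0 (negbTE y0) orbF => /eqP.
apply: IHp; apply: monicMXaddC (gm); apply: contraTneq gm => ->.
by rewrite c0 mul0r add0r monicE lead_coef0 eq_sym oner_eq0.
Qed.

(** Incomparability.  Take a monic [g] with [g(x)] in [P] and constant term [c].
    Since [x] lies in [I], so does [c].  If [c] lies in [P], then [x] times the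
    quotient of [g - c] by the variable lies in [P], and [x] does not, so the
    quotient is a monic polynomial of smaller degree with the same property. *)
Lemma prime_ideal_contraction_proper (P I : set B) (x : B) :
    prime_ideal P -> is_ideal I -> P `<=` I -> I x -> ~ P x ->
  exists2 c : A, I (phi c) & ~ P (phi c).
Proof.
move=> [[P0 PD PZ] PT Pprime] [I0 ID IZ] PI Ix nPx.
have nP1 : ~ P 1.
  move=> P1; move/eqP: PT; apply; apply/seteqP; split=> // y _.
  by rewrite -[y]mulr1; exact: PZ.
have [g gm g0] := ic_integral x.
have {g0} : P (map_poly phi g).[x] by rewrite g0.
elim/poly_ind: g gm => [|p c IHp] gm.
  by rewrite monicE lead_coef0 eq_sym oner_eq0 in gm.
rewrite horner_MXaddC_ic => Pg.
have [Pc|nPc] := pselect (P (phi c)); last first.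
  exists c => //; set y := _ * x in Pg.
  have -> : phi c = (y + phi c) + (- 1) * y by ring.
  by apply: ID; [exact: PI | exact/IZ/IZ].
have Py : P ((map_poly phi p).[x] * x).
  set y := _ * x in Pg *; have -> : y = (y + phi c) + (- 1) * phi c by ring.
  by apply: PD => //; apply: PZ.
have [p0|p0] := eqVneq p 0.
  rewrite p0 mul0r add0r monicE lead_coefC in gm.
  by case: nP1; rewrite -(rmorph1 phi) -(eqP gm).
by apply: IHp; [exact: monicMXaddC gm | case: (Pprime _ _ Py)].
Qed.

Lemma contraction_ideal (I : set B) : is_ideal I -> is_ideal [set a | I (phi a)].
Proof.
move=> [I0 ID IZ]; split=> [|a b Ia Ib|a b Ib] /=; first by rewrite rmorph0.
  by rewrite rmorphD; exact: ID.
by rewrite rmorphM; exact: IZ.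
Qed.

(** The contractions of [P] and of a larger ideal [I] are generated by [pi] and
    [de], with [pi = e * de].  As [P] is prime and [de] is not in [P] by incomparability,
    the factor [e] is a multiple of [pi], so [de] is a unit. *)
Lemma integral_closure_prime_maximal (P : set B) :
  prime_ideal P -> P != [set 0] -> maximal_ideal P.
Proof.
move=> Pp Pn0; have [Pi PT Pprime] := Pp; split=> // I Ii PI.
have [IP|] := pselect (I `<=` P); first by left; apply/seteqP.
move=> /existsNP[x /not_implyP[Ix nPx]]; right.
have [c Ic nPc] := prime_ideal_contraction_proper Pp Ii PI Ix nPx.
have [d d0 Pd] := prime_ideal_contraction_neq0 Pp Pn0.
have [pi piE] := A_PID (contraction_ideal Pi).
have [de deE] := A_PID (contraction_ideal Ii).
have Ppi : [set a | P (phi a)] pi by rewrite piE; exists 1; rewrite ?mul1r.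
have Ide : [set a | I (phi a)] de by rewrite deE; exists 1; rewrite ?mul1r.
have pi0 : pi != 0.
  have : [set a | P (phi a)] d by [].
  by rewrite piE => -[r _ rd]; apply: contraNneq d0 => pi0; rewrite -rd pi0 mulr0.
have [e _ eE] : principal_ideal de pi by rewrite -deE /=; exact: PI.
have [P0 PD PZ] := Pi; have [I0 ID IZ] := Ii.
have : P (phi e * phi de) by rewrite -rmorphM eE.
case/Pprime => [Pe|Pde]; last first.
  have : [set a | I (phi a)] c by [].
  by rewrite deE => -[r _ rc]; case: nPc; rewrite -rc rmorphM; exact: PZ.
have [u _ uE] : principal_ideal pi e by rewrite -piE.
have ude : u * de = 1.
  by apply: (mulIf pi0); rewrite mul1r -[RHS]eE -uE; ring.
apply/seteqP; split=> // y _; rewrite -[y]mulr1 -(rmorph1 phi) -ude rmorphM.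
exact/IZ/IZ.
Qed.

Theorem integral_closure_dedekind : dedekind_domain B.
Proof.
split.
- exact: integral_closure_noetherian.
- exact: integral_closure_integrally_closed.
- exact: integral_closure_prime_maximal.
Qed.

End Dedekind.

(** * Norms on the integers and on polynomials over a finite field *)

Section BasicPID.
Variable R : idomainType.

Lemma euclidean_PID (nu : R -> nat) :
    (forall a b : R, b != 0 -> exists q, a = q * b \/ (nu (a - q * b)%R < nu b)%N) ->
  principal_ideal_domain R.
Proof.
move=> euc I [I0 ID IZ].
have [[b [Ib b0]]|nI] := pselect (exists b, I b /\ b != 0); last first.
  exists 0; apply/seteqP; split=> x; last by case=> r _ <-; rewrite mulr0.
  move=> Ix; exists 0 => //; rewrite mulr0; apply/esym/eqP.
  by apply: contrapT => /negP x0; apply: nI; exists x.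
have [n nb] := ubnP (nu b); elim: n => // n IHn in b Ib b0 nb *.
have [Ib'|] := pselect (I `<=` principal_ideal b).
  by exists b; apply/seteqP; split=> // _ [r _ <-]; apply: IZ.
move=> /existsNP[a /not_implyP[Ia nba]].
have [q [aE|lt_nu]] := euc a _ b0; first by case: nba; exists q.
apply: (IHn (a - q * b)).
- by rewrite -mulNr; apply: ID => //; apply: IZ.
- by apply: contra_notN nba; rewrite subr_eq0 => /eqP->; exists q.
- exact: leq_trans lt_nu _.
Qed.

(* The types [T x] index systems of representatives of the quotients by [x]. *)
Variables (T : R -> finType) (g : forall x : R, T x -> R).
Hypothesis repr_ex : forall x a, x != 0 ->
  exists t, principal_ideal x (a - g (x := x) t).

Lemma finite_quotient_of_repr : finite_quotient_domain R.
Proof.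
move=> I [I0 ID IZ] In0.
have [x [Ix x0]] : exists x, I x /\ x != 0.
  apply: contrapT => nI; move/eqP: In0; apply; apply/seteqP; split=> x; last by move->.
  by move=> Ix; apply/eqP; apply: contrapT => /negP x0; apply: nI; exists x.
apply: (@card_le_finite _ _ _ ((fun t : T x => [set y | I (y - g t)]) @` setT)); last first.
  by apply: finite_image.
apply: subset_card_le => _ [a _ <-].
have [t [r _ rE]] := repr_ex a x0.
have It : I (a - g t) by rewrite -rE; exact: IZ.
exists t => //; apply/seteqP; split=> y /= Iy.
  have -> : y - a = y - g t + (- 1) * (a - g t) by ring.
  by apply: ID => //; exact: IZ.
have -> : y - g t = (y - a) + (a - g t) by ring.
exact: ID.
Qed.

Hypothesis repr_uniq : forall x (t t' : T x), x != 0 ->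
  principal_ideal x (g t - g t') -> t = t'.

Lemma ideal_norm_of_repr x : x != 0 -> ideal_norm x = #|T x|.
Proof.
move=> x0; rewrite /ideal_norm (negbTE x0).
set X := ideal_cosets _.
pose coset a : set R := [set y | principal_ideal x (y - a)].
have cosetE a b : principal_ideal x (a - b) -> coset a = coset b.
  move=> [r _ rE]; apply/seteqP; split=> y [s _ sE].
    by exists (s + r) => //; rewrite mulrDl sE rE; ring.
  by exists (s - r) => //; rewrite mulrBl sE rE; ring.
have X_fin : finite_set X.
  apply: finite_quotient_of_repr.
    split; first by exists 0; rewrite ?mul0r.
      by move=> _ _ [r _ <-] [s _ <-]; exists (r + s); rewrite ?mulrDl.
    by move=> a _ [r _ <-]; exists (a * r); rewrite ?mulrA.
  by apply: contraNneq x0 => xI; rewrite -in_set1 -[x]mul1r -xI inE; exists 1.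
have <- : size [seq coset (g t) | t : T x] = #|T x| by rewrite size_map cardE.
apply/perm_size/uniq_perm => [||Y].
- exact: fset_uniq.
- rewrite map_inj_in_uniq ?enum_uniq // => t t' _ _ tt'.
  apply: repr_uniq => //; have : coset (g t) (g t) by exists 0; rewrite ?mul0r ?subrr.
  by rewrite tt'.
rewrite in_fset_set //; apply/idP/mapP.
  rewrite inE => -[a _ <-]; have [t at_] := repr_ex a x0.
  by exists t; [rewrite mem_enum | exact: cosetE].
by case=> t _ ->; rewrite inE; exists (g t).
Qed.

End BasicPID.

Lemma card_II_le (U : choiceType) (S : set U) m (h : nat -> U) :
  (forall i, (i < m)%N -> S (h i)) ->
  (forall i j, (i < m)%N -> (j < m)%N -> h i = h j -> i = j) -> (`I_m #<= S)%card.
Proof.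
move=> Sh hinj; have /card_eqPle[_ mh] : (h @` `I_m #= `I_m)%card.
  by apply: inj_card_eq => i j; rewrite !inE; exact: hinj.
by apply: card_le_trans mh _; apply: subset_card_le => _ [i im <-]; exact: Sh.
Qed.

Lemma int_repr_ex (x a : int) : x != 0 ->
  exists t : 'I_(`|x|%N), principal_ideal x (a - (t : nat)%:Z).
Proof.
move=> x0; have xm : (`|(a %% x)%Z| < `|x|)%N.
  by rewrite -ltz_nat gez0_abs ?modz_ge0 // ltz_mod.
exists (Ordinal xm), (a %/ x)%Z => //=.
by rewrite gez0_abs ?modz_ge0 // {2}(divz_eq a x) addrK.
Qed.

Lemma int_repr_uniq (x : int) (t t' : 'I_(`|x|%N)) :
  principal_ideal x ((t : nat)%:Z - (t' : nat)%:Z) -> t = t'.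
Proof.
case=> r _ rE; apply: val_inj => /=.
have := congr1 absz rE; rewrite abszM => rE'.
have [r0|r0] := posnP `|r|%N; first by move: rE' (ltn_ord t) (ltn_ord t'); rewrite r0; lia.
have : (`|x| <= `|r| * `|x|)%N by rewrite leq_pmull.
by rewrite rE'; have := ltn_ord t; have := ltn_ord t'; lia.
Qed.

Lemma int_ideal_norm (x : int) : ideal_norm x = `|x|%N.
Proof.
have [->|x0] := eqVneq x 0; first by rewrite /ideal_norm eqxx.
rewrite (@ideal_norm_of_repr _ (fun x : int => 'I_(`|x|%N)) (fun x t => (t : nat)%:Z)) //.
- by rewrite card_ord.
- exact: int_repr_ex.
- by move=> y t t' _; exact: int_repr_uniq.
Qed.

(** The norm is the absolute value, and 0, ..., m - 1 are [m] elements of norm at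
    most [m]. *)
Theorem basic_PID_int : basic_PID int.
Proof.
split.
- apply: (euclidean_PID (nu := absz)) => a b b0; exists (a %/ b)%Z; right.
  rewrite {1}(divz_eq a b) addrC addKr.
  by rewrite -ltz_nat gez0_abs ?modz_ge0 // ltz_mod.
- by move=> /(_ 2%:Z isT).
- exact: (finite_quotient_of_repr int_repr_ex).
- exists 1%N => // m m0; apply: (card_II_le (h := Posz)) => [i im|i j _ _ [//]].
  by rewrite /= int_ideal_norm mul1n ltnW.
- by exists 1%N => // x y; rewrite !int_ideal_norm; lia.
Qed.

Section PolyBasicPID.
Variable F : finFieldType.
Local Notation q := #|F|.

Lemma poly_repr_ex (x a : {poly F}) : x != 0 ->
  exists t : 'rV[F]_(size x).-1, principal_ideal x (a - rVpoly t).
Proof.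
move=> x0; have sx : (size (a %% x)%R <= (size x).-1)%N.
  by rewrite -ltnS prednK ?size_poly_gt0 // ltn_modp.
exists (poly_rV (a %% x)), (a %/ x) => //=.
by rewrite poly_rV_K // {2}(divp_eq a x) addrK.
Qed.

Lemma poly_repr_uniq (x : {poly F}) (t t' : 'rV[F]_(size x).-1) : x != 0 ->
  principal_ideal x (rVpoly t - rVpoly t') -> t = t'.
Proof.
move=> x0 [r _ rE]; apply: (can_inj (@rVpolyK _ _)); apply/eqP.
rewrite -subr_eq0 -rE; apply: contraT => rx0.
have r0 : r != 0 by apply: contraNneq rx0 => ->; rewrite mul0r.
have : (size (r * x)%R <= (size x).-1)%N by rewrite rE -raddfB size_poly.
rewrite size_mul // -(prednK (n := size r)) ?size_poly_gt0 // addSn /=.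
have : (0 < size x)%N by rewrite size_poly_gt0.
by case: (size x) => // n _; rewrite addnS ltnNge leq_addl.
Qed.

Lemma poly_ideal_norm (x : {poly F}) :
  ideal_norm x = if x == 0 then 0%N else (q ^ (size x).-1)%N.
Proof.
case: eqP => [->|/eqP x0]; first by rewrite /ideal_norm eqxx.
rewrite (@ideal_norm_of_repr _ (fun x : {poly F} => 'rV[F]_(size x).-1)
          (fun x t => rVpoly t)) //.
- by rewrite card_mx mul1n.
- exact: poly_repr_ex.
- exact: poly_repr_uniq.
Qed.

(** The norm of a nonzero [x] is [q ^ deg x].  For [q ^ e <= m < q ^ e.+1], the
    polynomials of degree at most [e] have norm at most [m], and there are
    [q ^ e.+1] of them. *)
Theorem basic_PID_poly : basic_PID {poly F}.
Proof.
have q1 : (1 < q)%N := card_finNzRing_gt1 F.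
split.
- apply: (euclidean_PID (nu := fun p : {poly F} => size p)) => a b b0.
  exists (a %/ b); right.
  by rewrite {1}(divp_eq a b) addrC addKr ltn_modp.
- move=> /(_ 'X); rewrite polyX_eq0 poly_unitE size_polyX => /(_ isT).
  by [].
- exact: (finite_quotient_of_repr poly_repr_ex).
- exists 1%N => // m m0; set e := trunc_log q m.
  pose h i : {poly F} := rVpoly (nth 0 (enum {: 'rV[F]_e.+1}) i).
  have mT : (m < #|{: 'rV[F]_e.+1}|)%N by rewrite card_mx mul1n trunc_log_ltn.
  apply: (card_II_le (h := h)) => [i im|i j im jm].
    rewrite /= poly_ideal_norm mul1n; case: eqP => // _.
    apply: leq_trans (trunc_logP q1 m0); rewrite leq_pexp2l ?(ltnW q1) //.
    by rewrite -subn1 leq_subLR add1n; exact: size_poly.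
  have lt_enum l : (l < m)%N -> (l < size (enum {: 'rV[F]_e.+1}))%N.
    by move=> lm; rewrite -cardE (ltn_trans lm mT).
  move=> /(can_inj (@rVpolyK _ _))/eqP.
  by rewrite nth_uniq ?enum_uniq ?lt_enum // => /eqP.
- exists 1%N => // x y; rewrite mul1n !poly_ideal_norm.
  case: (eqVneq x 0) => [->|x0]; first by rewrite !add0r add0n.
  case: (eqVneq y 0) => [->|y0]; first by rewrite addr0 addn0 (negbTE x0).
  case: eqP => // _; have := size_polyD x y; rewrite leq_max => /orP[] s.
    by apply: leq_trans (leq_addr _ _); rewrite leq_pexp2l ?(ltnW q1) // -!subn1 leq_sub2r.
  by apply: leq_trans (leq_addl _ _); rewrite leq_pexp2l ?(ltnW q1) // -!subn1 leq_sub2r.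
Qed.

(** As [F] is finite, the injective map [x |-> x ^+ n] is onto, so the monomial
    [a 'X^i] is ['X^(i %% n)] times an [n]-th power. *)
Lemma poly_frobenius_span (n : nat) : [pchar {poly F}].-nat n ->
  exists r (g : nat -> {poly F}), forall a, exists c : nat -> {poly F},
    a = \sum_(j < r) c j ^+ n * g j.
Proof.
move=> np; have nF : [pchar F].-nat n.
  apply: sub_in_pnat np => p _ pP.
  exact: (rmorph_pchar (horner_eval (0 : F))) pP.
have n0 : (0 < n)%N by case/andP: np.
have expN (x y : F) : x ^+ n = y ^+ n -> x = y.
  move=> /eqP; rewrite -subr_eq0 -exprNn_pchar // -exprDn_pchar // expf_eq0 n0 subr_eq0.
  by move/eqP.
have root_ex (b : F) : exists c, b = c ^+ n.
  by exists (invF expN b); rewrite (f_invF expN).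
exists n, (fun j => 'X^j) => a; rewrite -[a]coefK poly_def.
elim/big_ind: _ => [|_ _ [c ->] [c' ->]|i _].
- by exists (fun=> 0); rewrite big1 // => i _; rewrite expr0n gtn_eqF // mul0r.
- exists (fun j => c j + c' j); rewrite -big_split; apply: eq_bigr => j _ /=.
  by rewrite exprDn_pchar // mulrDl.
have [b bE] := root_ex a`_i.
exists (fun j => if j == (i %% n)%N then b *: 'X^(i %/ n) else 0).
have im : (i %% n < n)%N by rewrite ltn_mod.
rewrite (bigD1 (Ordinal im)) //= eqxx big1 ?addr0.
  by rewrite exprZn -bE -exprM -scalerAl -exprD -divn_eq.
move=> j; rewrite -val_eqE /= => /negbTE->.
by rewrite expr0n gtn_eqF // mul0r.
Qed.

End PolyBasicPID.

(** * Change of the base field *)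

Lemma field_PID (k : fieldType) : principal_ideal_domain k.
Proof.
apply: (euclidean_PID (nu := fun=> 0%N)) => a b b0.
by exists (a / b); left; rewrite divfK.
Qed.

(** The finiteness hypothesis is a parameter of the type so that the instances
    below, up to the one of finite-dimensional space, can be attached to it. *)
Definition scalars_along (k K : fieldType) (j : {rmorphism k -> K})
  (fin : exists m v, forall x, lin_span j m v x) : Type := K.

Section ScalarsAlong.
Variables (k K : fieldType) (j : {rmorphism k -> K}).
Hypothesis fin : exists m v, forall x, lin_span j m v x.
Local Notation L := (scalars_along fin).

HB.instance Definition _ := GRing.Field.on L.

Let scale (a : k) (x : L) : L := j a * (x : K).

Let scaleA a b v : scale a (scale b v) = scale (a * b) v.
Proof. by rewrite /scale rmorphM mulrA. Qed.
Let scale1 : left_id 1 scale.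
Proof. by move=> x; rewrite /scale rmorph1 mul1r. Qed.
Let scaleDr : right_distributive scale +%R.
Proof. by move=> a x y; exact: mulrDr. Qed.
Let scaleDl v : {morph scale^~ v : a b / a + b}.
Proof. by move=> a b; rewrite /scale rmorphD mulrDl. Qed.

HB.instance Definition _ :=
  GRing.Zmodule_isLmodule.Build k L scaleA scale1 scaleDr scaleDl.

Let scaleAl (a : k) (x y : L) : a *: (x * y) = a *: x * y.
Proof. exact: mulrA. Qed.
HB.instance Definition _ := GRing.Lmodule_isLalgebra.Build k L scaleAl.

Let scaleAr (a : k) (x y : L) : a *: (x * y) = x * (a *: y).
Proof. exact: mulrCA. Qed.
HB.instance Definition _ := GRing.Lalgebra_isAlgebra.Build k L scaleAr.

Lemma scalars_along_vector : exists n, inhabited (Vector.axiom n L).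
Proof.
have [m [v vP]] := fin.
have [|s _||n [b [_ _ sb ib]]] :=
  submodule_basis (@field_PID k) (f := j) (S := setT) (m := m) (v := v) (oner_neq0 k).
- by [].
- exact: vP.
- exact: fmorph_inj.
have /choice[c cE] : forall x, exists c : nat -> k, x = \sum_(i < n) j (c i) * b i.
  by move=> x; apply: sb.
have c_uniq (d : nat -> k) x i : (i < n)%N -> x = \sum_(i < n) j (d i) * b i -> c x i = d i.
  move=> lin xE; apply/eqP; rewrite -subr_eq0; apply/eqP.
  apply: (ib (fun i => c x i - d i)) => //.
  under eq_bigr => l _ do rewrite rmorphB mulrBl.
  by rewrite sumrB -cE -xE subrr.
exists n; constructor; exists (fun x : L => \row_i c x i).
  move=> a x y; apply/rowP => i; rewrite !mxE.
  apply: (c_uniq (fun i => a * c x i + c y i)) => //.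
  rewrite [x in LHS]cE [y in LHS]cE.
  rewrite -[_ *: _]/(j a * _) mulr_sumr -big_split /=.
  by apply: eq_bigr => l _; rewrite rmorphD rmorphM; ring.
exists (fun r : 'rV_n => (\sum_(i < n) j (r 0 i) * b i : K)) => [x|r].
  by rewrite [RHS]cE; apply: eq_bigr => i _; rewrite mxE.
apply/rowP => i; rewrite mxE.
have -> : r 0 i = oapp (fun l => r 0 l) 0 (insub (i : nat)) by rewrite valK.
apply: (c_uniq (fun i => oapp (fun l => r 0 l) 0 (insub i))) => //.
by apply: eq_bigr => l _; rewrite valK.
Qed.

Let dim_axiom := cid scalars_along_vector.

HB.instance Definition _ := Lmodule_hasFinDim.Build k L
  (inhabited_witness (projT2 dim_axiom)).

Definition scalars_along_ext : fieldExtType k := L.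

Lemma scalars_along_scalar a : a%:A = j a :> scalars_along_ext.
Proof. exact: mulr1. Qed.

End ScalarsAlong.

(** The same finiteness for a morphism [j] that need not be the structure
    morphism of [K]. *)
Theorem finite_free_of_finite_ext (A : idomainType) (k K : fieldType)
    (iota : {rmorphism A -> k}) (j : {rmorphism k -> K}) (f : {rmorphism A -> K}) :
    principal_ideal_domain A ->
    (forall q, [pchar A].-nat q -> exists r (g : nat -> A), forall a,
       exists c : nat -> A, a = \sum_(j < r) c j ^+ q * g j) ->
    injective iota ->
    (forall z : k, exists2 b, b != 0 & exists a, iota b * z = iota a) ->
    (exists m v, forall x, lin_span j m v x) ->
    (forall a, f a = j (iota a)) ->
  finite_free_module (ic_map f).
Proof.
move=> A_PID A_pow iota_inj frac; move: K j f.
(* Record eta is not definitional: only a destructured [K] is convertible to the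
   field structure underlying the extension rebuilt on its carrier. *)
case=> T []; do 15![move=> ?]; move=> j f fin fE.
have fE' (a : A) : (f a : scalars_along_ext fin) = (iota a)%:A.
  by rewrite scalars_along_scalar fE.
exact: (@finite_free_integral_closure A k iota iota_inj frac
         (scalars_along_ext fin) f fE' A_PID A_pow).
Qed.

(** * Finiteness over the chosen rational subfield *)

Section FractionLift.
Variables (R : idomainType) (L : fieldType) (g : {rmorphism R -> L}).
Hypothesis ginj : injective g.
Local Notation tofrac := (@FracField.tofrac R).

Definition frac_lift (z : {fraction R}) : L := g (\n_(repr z)) / g (\d_(repr z)).

Let g_neq0 b : b != 0 -> g b != 0.
Proof. by rewrite -(rmorph0 g) (inj_eq ginj). Qed.

Lemma frac_liftE a b z : b != 0 -> tofrac b * z = tofrac a -> frac_lift z = g a / g b.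
Proof.
move=> b0 bz; apply/eqP; rewrite eqr_div ?g_neq0 ?denom_ratioP // -!rmorphM.
rewrite (inj_eq ginj) -tofrac_eq !tofracM -fraction_reprE -bz; apply/eqP; ring.
Qed.

Let frac_lift_zmod : zmod_morphism frac_lift.
Proof.
move=> y z; have [b b0 [a bE]] := fraction_repr y.
have [d d0 [c dE]] := fraction_repr z.
rewrite (frac_liftE b0 bE) (frac_liftE d0 dE).
rewrite (frac_liftE (a := a * d - c * b) (b := b * d)) ?mulf_neq0 //.
  rewrite rmorphB !rmorphM mulrBl; congr (_ - _).
    by rewrite -mulf_div divff ?g_neq0 // mulr1.
  by rewrite [g b * g d]mulrC -mulf_div divff ?g_neq0 // mulr1.
by rewrite tofracB !tofracM -bE -dE; ring.
Qed.

Let frac_lift_monoid : monoid_morphism frac_lift.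
Proof.
split=> [|y z].
  by rewrite (frac_liftE (oner_neq0 R) (mulr1 _)) divff ?g_neq0 ?oner_neq0.
have [b b0 [a bE]] := fraction_repr y; have [d d0 [c dE]] := fraction_repr z.
rewrite (frac_liftE b0 bE) (frac_liftE d0 dE).
rewrite (frac_liftE (a := a * c) (b := b * d)) ?mulf_neq0 //.
  by rewrite !rmorphM mulf_div.
by rewrite !tofracM -bE -dE; ring.
Qed.

Definition frac_rmorphism : {rmorphism {fraction R} -> L} :=
  HB.pack frac_lift
    (GRing.isZmodMorphism.Build _ _ frac_lift frac_lift_zmod)
    (GRing.isMonoidMorphism.Build _ _ frac_lift frac_lift_monoid).

Lemma frac_lift_tofrac a : frac_lift (tofrac a) = g a.
Proof.
by rewrite (frac_liftE (a := a) (oner_neq0 R)) ?rmorph1 ?divr1 ?mul1r.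
Qed.

End FractionLift.

Section AlgebraicElement.
Variables (k K : fieldType) (j : {rmorphism k -> K}) (s : K).
Hypothesis s_alg : integralOver j s.

(** Subrings of the form [k[s]] with [s] algebraic are fields: dividing an equation
    of the value [y] by powers of [y] makes its constant term [c] nonzero, and
    then [y^-1] is [- c^-1] times a polynomial in [y]. *)
Lemma inv_horner_alg (g : {poly k}) :
  exists h : {poly k}, ((map_poly j g).[s])^-1 = (map_poly j h).[s].
Proof.
set y := _.[s].
have [y0|y0] := eqVneq y 0; first by exists 0; rewrite y0 invr0 rmorph0 horner0.
have [p pm /rootP p0] : integralOver j y.
  apply: integral_horner => //; apply/integral_poly => i.
  by rewrite coef_map; exact: integral_id.
have {pm} : p != 0 by exact: monic_neq0.
elim/poly_ind: p p0 => [|p c IHp]; first by rewrite eqxx.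
rewrite rmorphD rmorphM /= map_polyX map_polyC hornerMXaddC.
have [c0|c0] := eqVneq c 0.
  move=> py pX0; apply: IHp.
    by apply: (mulIf y0); rewrite mul0r -[RHS]py c0 raddf0 addr0.
  by apply: contraNneq pX0 => ->; rewrite c0 mul0r addr0.
move=> /eqP; rewrite addr_eq0 => /eqP cE _.
exists (- c^-1 *: (p \Po g)).
have jc0 : j c != 0 by rewrite fmorph_eq0.
apply: (mulIf y0); rewrite mulVf // map_polyZ hornerZ map_comp_poly horner_comp.
by rewrite -mulrA cE rmorphN fmorphV mulrNN mulVf.
Qed.

End AlgebraicElement.

Lemma horner_swapXY (R : comNzRingType) (u : {poly {poly R}}) (x y : R) :
  (map_poly (horner_eval x) u).[y] = (map_poly (horner_eval y) (swapXY u)).[x].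
Proof.
elim/poly_ind: u => [|u c IHu]; first by rewrite !rmorph0 !horner0.
have cE : map_poly (horner_eval y) (map_poly polyC c) = c.
  by rewrite -map_poly_comp map_poly_id // => a _ /=; rewrite /horner_eval hornerC.
rewrite !rmorphD !rmorphM /= swapXY_X swapXY_polyC !map_polyX !map_polyC /= cE.
by rewrite !hornerE IHu /horner_eval hornerX.
Qed.

Section FunctionField.
Variables (F : finFieldType) (K : fieldExtType {fraction {poly F}}).
Variable t : K.
Hypothesis t_trans : transcendental t.
Local Notation tofrac := (@FracField.tofrac {poly F}).
Local Notation c := (@constant_map F K).

Lemma eval_map_inj : injective (eval_map t).
Proof.
apply: raddf_inj => p p0; apply/eqP; apply: contrapT => /negP pn0.
by apply: t_trans; exists p => //; exact/rootP.
Qed.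

Let j : {rmorphism {fraction {poly F}} -> K} := frac_rmorphism eval_map_inj.
Let h : {rmorphism {poly F} -> K} := in_alg K \o tofrac.
Let s : K := h 'X.

Let jE p : j (tofrac p) = eval_map t p.
Proof. exact: frac_lift_tofrac eval_map_inj p. Qed.

Let hE p : h p = (map_poly c p).[s].
Proof.
elim/poly_ind: p => [|p a IHp]; first by rewrite !rmorph0 horner0.
by rewrite !rmorphD !rmorphM IHp /= map_polyX map_polyC !hornerE.
Qed.

(* An equation of [t] over [F(s)], cleared of denominators, is a polynomial
   relation between [s] and [t]; read in [s], it is nontrivial because [t] is
   transcendental. *)
Let s_alg : integralOver j s.
Proof.
apply/integral_algebraic.
have tofrac_inj : injective tofrac by move=> a b /eqP; rewrite tofrac_eq => /eqP.
have [q [q1 /rootP q0]] := algebraic_over_subring tofrac_inj (@fraction_repr _)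
  (f := h) (fun=> erefl) t.
have qn0 : swapXY q != 0 by rewrite swapXY_eq0 -size_poly_gt0 ltnW.
exists (map_poly tofrac (swapXY q)).
  by rewrite map_poly_eq0_id0 // tofrac_eq0 lead_coef_eq0.
apply/rootP; rewrite -map_poly_comp (eq_map_poly jE).
have -> : map_poly (eval_map t) (swapXY q) =
    map_poly (horner_eval t) (swapXY (map_poly (map_poly c) q)).
  by rewrite swapXY_map -map_poly_comp.
rewrite -horner_swapXY -map_poly_comp -[RHS]q0; congr horner.
by apply: eq_map_poly => a; rewrite hE.
Qed.

(** The extensions [K / F(s)] and [F(s, t) / F(t)] are finite, and the latter
    contains [F(s)]. *)
Lemma finite_over_transcendental : exists m v, forall x, lin_span j m v x.
Proof.
have [p pm p0] := s_alg.
set E := size p; set n := \dim {:K}; set e := vbasis {:K}.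
have jh (g : {poly F}) : exists g', h g = (map_poly j g').[s].
  exists (map_poly (tofrac \o polyC) g); rewrite hE -map_poly_comp.
  congr horner; apply: eq_map_poly => a.
  rewrite -[RHS]/(j (tofrac a%:P)) jE /eval_map /=.
  by rewrite map_polyC /horner_eval hornerC.
have span_scalar z : lin_span j E (fun i => s ^+ i) (in_alg K z).
  have [b b0 [a bz]] := fraction_repr z.
  have hb0 : h b != 0 by rewrite fmorph_eq0 tofrac_eq0.
  have -> : in_alg K z = h a / h b.
    by apply: (mulIf hb0); rewrite divfK // -rmorphM mulrC bz.
  have [a' ->] := jh a; have [b' ->] := jh b.
  have [b'' ->] := inv_horner_alg s_alg b'.
  rewrite -hornerM -rmorphM.
  have [r rp ->] := @monic_rmodp _ _ j p (a' * b'') s pm p0.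
  exact: map_poly_horner_span (ltnW rp).
pose v l := s ^+ (l %% E) * e`_(l %/ E).
exists (n * E)%N, v => x; have spm := lin_span_submod j (n * E) v.
rewrite (coord_vbasis (memvf x)).
pose d l := oapp (fun i => coord e i x) 0 (insub l).
under eq_bigr => i _.
  have -> : coord (vbasis {:K}) i x = d i by rewrite /d valK.
  over.
apply: (submod_sum (F := fun i => d i *: e`_i) spm) => i lin.
rewrite -mulr_algl -[_%:A]/(in_alg K (d i)).
have [a ->] := span_scalar (d i); rewrite mulr_suml.
apply: (submod_sum (F := fun l => j (a l) * s ^+ l * e`_i) spm) => l lE.
have vE : v (i * E + l)%N = s ^+ l * e`_i.
  by rewrite /v divnMDl ?(leq_ltn_trans _ lE) // divn_small // addn0 modnMDl modn_small.
rewrite -mulrA -vE; apply: (submodZ spm); apply: mem_lin_span.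
by rewrite (@leq_trans (i * E + E)) ?ltn_add2l // -mulSnr leq_mul2r lin orbT.
Qed.

End FunctionField.

(** * Rings of integers of global fields *)

Lemma int_frobenius_span (n : nat) : [pchar int].-nat n ->
  exists r (g : nat -> int), forall a, exists c : nat -> int,
    a = \sum_(j < r) c j ^+ n * g j.
Proof.
move=> np; have -> : n = 1%N.
  by apply: (pnat_1 np); apply: sub_in_pnat np => p _; rewrite Num.Theory.pchar_num.
by exists 1%N, (fun=> 1) => a; exists (fun=> a); rewrite big_ord1 mulr1.
Qed.

Lemma rat_frac (z : rat) : exists2 b : int, b != 0 & exists a : int, b%:~R * z = a%:~R.
Proof.
exists (denq z); first exact: denq_neq0.
by exists (numq z); rewrite mulrC numqE.
Qed.

Theorem proposition4 :
  (forall K : fieldExtType rat,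
     basic_PID int /\ class_G (ic_map (intr : {rmorphism int -> K})))
  /\
  (forall (F : finFieldType) (K : fieldExtType {fraction {poly F}}),
     separable 1%VS (fullv : {vspace K}) ->
     forall t : K, transcendental t ->
     basic_PID {poly F} /\ class_G (ic_map (eval_map t))).
Proof.
split=> [K|F K _ t t_trans]; split.
- exact: basic_PID_int.
- have intr_rat : injective (intr : int -> rat) by exact: intr_inj.
  have intrE a : (intr a : K) = (intr a : rat)%:A.
    by rewrite -[RHS]/(in_alg K _) rmorph_int.
  have intrK : injective (intr : int -> K).
    by move=> a b; rewrite !intrE => /(fmorph_inj (in_alg K))/intr_rat.
  suff free : finite_free_module (ic_map (intr : {rmorphism int -> K})).
    split=> //; exact: integral_closure_dedekind intrK (basic_PID_principal basic_PID_int) free.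
  exact: (finite_free_integral_closure intr_rat rat_frac intrE
    (basic_PID_principal basic_PID_int) int_frobenius_span).
- exact: basic_PID_poly.
- have polyPID := basic_PID_principal (basic_PID_poly F).
  suff free : finite_free_module (ic_map (eval_map t)).
    split=> //; exact: integral_closure_dedekind (eval_map_inj t_trans) polyPID free.
  apply: (finite_free_of_finite_ext polyPID (@poly_frobenius_span F) _
    (@fraction_repr _) (finite_over_transcendental t_trans)).
    by move=> a b /eqP; rewrite tofrac_eq => /eqP.
  by move=> a; exact: esym (frac_lift_tofrac (eval_map_inj t_trans) a).
Qed.
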